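(* Let $\boldsymbol\mu=(\mu_1,\dots,\mu_s)$ be a valuated flag matroid of rank $\mathbf d=(d_1<\dots<d_s)$ on $[n]$. For a Plücker pair $(S,T)$ let $t_1<\dots<t_k$ be the elements of $T\setminus S$, let $\lambda_j=\lambda^{S,T}_j$ ($1\le j\le k$) be its lambda-values, and set $\lambda_0=\lambda_{k+1}=\infty$. \begin{enumerate} \item If $\boldsymbol\mu$ is totally non-negative, then $\lambda_i\ge\min(\lambda_{i-1},\lambda_{i+1})$ for every Plücker pair $(S,T)$ and every $1\le i\le k$. \item If $\boldsymbol\mu$ induces a Bruhat subdivision, then $\lambda_i=\min(\lambda_{i-1},\lambda_{i+1})$ for every Plücker pair $(S,T)$ and every $i$ with $\lambda_i=\min(\lambda_1,\dots,\lambda_k)$. \item If $\boldsymbol\mu$ induces a flag positroid subdivision, then $\min_{i\text{ odd}}\lambda_i=\min_{i\text{ even}}\lambda_i$ for every Plücker pair $(S,T)$. \end{enumerate}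
   Context: A Plücker pair is a pair of subsets $S\subseteq T\subseteq[n]$ such that $S\in\binom{[n]}{d_i-1}$ and either $T\in\binom{[n]}{d_{i+1}+1}$ for some $i\in[s-1]$, or $T\in\binom{[n]}{d_i+1}$ for some $i\in[s]$. Its lambda-values are $\lambda^{S,T}_j=\mu(S\cup\{t_j\})+\mu(T\setminus\{t_j\})$, where $\mu(B)$ means $\mu_r(B)$ for the constituent $\mu_r$ of rank $|B|$. Conventions: $\mathbb{T}=\mathbb{R}\cup\{\infty\}$, $e_B=\sum_{i\in B}e_i$. A valuated matroid of rank $d$ on $[n]$ is a function $\mu:\binom{[n]}{d}\to\mathbb{T}$, not identically $\infty$, such that for all $S\in\binom{[n]}{d-1}$, $T\in\binom{[n]}{d+1}$ the minimum of $\mu(S\cup t)+\mu(T\setminus t)$ over $t\in T\setminus S$ is attained at least twice (or is $\infty$). A valuated flag matroid of rank $\mathbf d$ is a tuple of valuated matroids $\mu_j$ of ranks $d_j$ such that for all $j<k$, $S\in\binom{[n]}{d_j-1}$, $T\in\binom{[n]}{d_k+1}$, the minimum of $\mu_j(S\cup t)+\mu_k(T\setminus t)$ over $t\in T\setminus S$ is attained at least twice (or is $\infty$). Its support $\mathbf M$ has constituents with bases $\{B:\mu_j(B)<\infty\}$ and polytope $P_{\mathbf M}=\sum_j\operatorname{conv}\{e_B:\mu_j(B)<\infty\}$. For $x\in\mathbb{R}^n$, $P^x=\sum_j\operatorname{conv}\{e_B:B\text{ minimizes }\mu_j(B)-x\cdot e_B\}$; the subdivision induced by $\boldsymbol\mu$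 consists of all $P^x$. Positivity: $K$ = field of generalized Puiseux series with real coefficients, valuation $\operatorname{val}$, $K_{\ge0}$ = $\{0\}\cup\{$series with positive leading coefficient$\}$. Plücker coordinates $p_B(L)$ of a $d$-dimensional $L\subseteq K^n$ are maximal minors of a matrix with row span $L$ (up to common scalar). $\boldsymbol\mu$ is totally non-negative if there is a complete flag $L_1\subset\dots\subset L_n=K^n$ with all Plücker coordinates (in all dimensions) chosen in $K_{\ge0}$ and with $\mu_j(B)=\operatorname{val}p_B(L_{d_j})+c_j$ for constants $c_j$. A flag positroid is a flag matroid realized by a flag of real subspaces with all Plücker coordinates $\ge0$; a flag positroid subdivision is one all of whose cells are polytopes of flag positroids. Bruhat polytopes: for $x\in\operatorname{Sym}_n$ let $\pi(x)\in\mathbb{R}^n$ have $k$-th coordinate $\#\{j:x(k)\ge n+1-d_j\}$; $v$ is minimal if it is Bruhat-minimal among all $x$ with $\pi(x)=\pi(v)$; for $u\le v$ (Bruhat order) with $v$ minimal, $Q^{\mathbf d}_{u,v}=\operatorname{conv}\{\pi(x):u\le x\le v\}$. A Bruhat subdivision is one all of whose cells are such polytopes. *)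

(* Defs.v *)
From HB Require Import structures.
From mathcomp Require Import all_boot all_order all_algebra all_fingroup.
From mathcomp Require Import boolp classical_sets functions cardinality fsbigop.
From mathcomp Require Import reals constructive_ereal ereal.
From Stdlib Require Import Relations.

Set Implicit Arguments.
Unset Strict Implicit.
Unset Printing Implicit Defensive.

Import Order.TTheory GRing.Theory Num.Theory.
Local Open Scope classical_set_scope.
Local Open Scope ring_scope.

Section Defs.
Variable R : realType.

(* Generalized Puiseux series with real coefficients.                  *)
(* A series  sum_a f(a) t^a  is represented by its coefficient function *)
(* f : R -> R.  It is a generalized Puiseux series when its support is  *)
(* finite or a strictly increasing sequence tending to infinity, i.e.   *)
(* when every half-line (-oo, M] meets the support in a finite set.     *)
Definition series := R -> R.
Definition supp (f : series) : set R := [set a | f a != 0].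
Definition gpuiseux (f : series) : Prop :=
  forall M : R, finite_set [set a | f a != 0 /\ a <= M].

Definition zeroS : series := fun _ => 0.
Definition oneS : series := fun a => if a == 0 then 1 else 0.
Definition addS (f g : series) : series := fun a => f a + g a.
Definition scaleS (c : R) (f : series) : series := fun a => c * f a.
(* Cauchy product: (fg)(c) = sum_{a} f(a) g(c - a) (a finite sum for   *)
(* generalized Puiseux series).                                         *)
Definition mulS (f g : series) : series :=
  fun c => \sum_(a \in supp f) f a * g (c - a).

(* valuation: smallest exponent in the support; val 0 = +oo *)
Definition valS (f : series) : \bar R :=
  ereal_inf [set a%:E | a in supp f].

Definition nonnegS (f : series) : Prop :=
  f = zeroS \/ exists a0, 0 < f a0 /\ forall b, b < a0 -> f b = 0.

Definition detS d (M : 'I_d -> 'I_d -> series) : series :=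
  \big[addS/zeroS]_(sg : 'S_d)
     scaleS ((-1) ^+ sg) (\big[mulS/oneS]_(i : 'I_d) M i (sg i)).

Variable n : nat.

(* For a matrix given by its rows A 0, A 1, ... (row i : 'I_n -> entry), *)
(* pl A B = the maximal minor of the first #|B| rows on the columns B    *)
(* (taken in increasing order).                                          *)
Definition plS (A : nat -> 'I_n -> series) (B : {set 'I_n}) : series :=
  detS (fun (i k : 'I_#|B|) => A (nat_of_ord i) (@enum_val _ (mem B) k)).

Definition plR (A : nat -> 'I_n -> R) (B : {set 'I_n}) : R :=
  \det (\matrix_(i < #|B|, k < #|B|) A (nat_of_ord i) (@enum_val _ (mem B) k)).

(* Valuated (flag) matroids, with T = R u {+oo} taken inside \bar R     *)
(* (values -oo are excluded).                                           *)
Local Open Scope ereal_scope.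

Definition min_twice (f : 'I_n -> \bar R) (A : {set 'I_n}) : Prop :=
  forall t, t \in A -> (forall t', t' \in A -> f t <= f t') -> f t != +oo ->
    exists t', [/\ t' \in A, t' != t & f t' = f t].

Definition trop_plucker (m1 m2 : {set 'I_n} -> \bar R) (d1 d2 : nat) : Prop :=
  (0 < d1)%N -> forall S T : {set 'I_n}, #|S| = d1.-1 -> #|T| = d2.+1 ->
    min_twice (fun t => m1 (t |: S) + m2 (T :\ t)) (T :\: S).

Definition valuated_matroid (d : nat) (m : {set 'I_n} -> \bar R) : Prop :=
  [/\ forall B : {set 'I_n}, #|B| = d -> m B != -oo,
      exists B : {set 'I_n}, #|B| = d /\ m B != +oo
    & trop_plucker m m d d].

Variable s : nat.

Definition valuated_flag_matroid (d : 'I_s -> nat)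
    (mu : 'I_s -> {set 'I_n} -> \bar R) : Prop :=
  [/\ forall j k : 'I_s, (j < k)%N -> (d j < d k)%N,
      forall j, valuated_matroid (d j) (mu j)
    & forall j k : 'I_s, (j < k)%N -> trop_plucker (mu j) (mu k) (d j) (d k)].

Definition plucker_pair (d : 'I_s -> nat) (i i' : 'I_s) (S T : {set 'I_n}) : Prop :=
  [/\ (0 < d i)%N, S \subset T, #|S| = (d i).-1, #|T| = (d i').+1
    & (i' = i \/ nat_of_ord i' = (nat_of_ord i).+1)].

Definition lamseq (mu : 'I_s -> {set 'I_n} -> \bar R) (i i' : 'I_s)
    (S T : {set 'I_n}) : seq (\bar R) :=
  [seq mu i (t |: S) + mu i' (T :\ t) | t <- enum (T :\: S)].

(* lambda_j for j = 0, ..., k+1, with lambda_0 = lambda_{k+1} = +oo *)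
Definition lamx mu i i' S T (j : nat) : \bar R :=
  if j == 0%N then +oo else nth +oo (lamseq mu i i' S T) j.-1.

Definition totally_nonneg (d : 'I_s -> nat) (mu : 'I_s -> {set 'I_n} -> \bar R) :
  Prop :=
  exists (A : nat -> 'I_n -> series) (sc : nat -> series),
    [/\
        forall i j, gpuiseux (A i j),
        (* the rows A 0, ..., A (n-1) form a basis of K^n, so the spans of *)
        (* the first m rows give a complete flag L_1 < ... < L_n = K^n    *)
        plS A [set: 'I_n] != zeroS,
        forall m, (m <= n)%N ->
          [/\ gpuiseux (sc m), sc m != zeroS &
              forall B : {set 'I_n}, #|B| = m -> nonnegS (mulS (sc m) (plS A B))]
      & exists c : 'I_s -> R, forall j (B : {set 'I_n}), #|B| = d j ->
          mu j B = valS (mulS (sc (d j)) (plS A B)) + (c j)%:E].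

Local Close Scope ereal_scope.

Definition eB (B : {set 'I_n}) : 'rV[R]_n := \row_i (i \in B)%:R.

Definition conv (V : set 'rV[R]_n) : set 'rV[R]_n :=
  [set p | exists (m : nat) (c : 'I_m -> R) (v : 'I_m -> 'rV[R]_n),
     [/\ forall i, 0 <= c i, \sum_i c i = 1, forall i, V (v i)
       & p = \sum_i c i *: v i]].

Definition msum (P : 'I_s -> set 'rV[R]_n) : set 'rV[R]_n :=
  [set p | exists q : 'I_s -> 'rV[R]_n,
     (forall j, P j (q j)) /\ p = \sum_j q j].

Definition dotB (x : 'rV[R]_n) (B : {set 'I_n}) : R := \sum_(i in B) x ord0 i.

Definition cell (d : 'I_s -> nat) (mu : 'I_s -> {set 'I_n} -> \bar R)
    (x : 'rV[R]_n) : set 'rV[R]_n :=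
  msum (fun j => conv [set eB B | B in
     [set B : {set 'I_n} | #|B| = d j /\
        forall B' : {set 'I_n}, #|B'| = d j ->
          (mu j B - (dotB x B)%:E <= mu j B' - (dotB x B')%:E)%E]]).

Definition inv_num (u : {perm 'I_n}) : nat :=
  #|[set p : 'I_n * 'I_n | (p.1 < p.2)%N && (u p.2 < u p.1)%N]|.

Definition bruhat_step (u w : {perm 'I_n}) : Prop :=
  exists a b : 'I_n, [/\ a != b, w = (u * tperm a b)%g & (inv_num u < inv_num w)%N].

Definition bruhat_le : relation {perm 'I_n} := clos_refl_trans _ bruhat_step.

(* pi(x)_k = #{ j : x(k) >= n+1-d_j } with values of x in {1..n};   *)
(* here values are 0-based (x k in {0..n-1}), so the test is         *)
(* x k >= n - d_j.                                                   *)
Definition piB (d : 'I_s -> nat) (x : {perm 'I_n}) : 'rV[R]_n :=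
  \row_k (#|[set j : 'I_s | (n - d j <= x k)%N]|)%:R.

Definition bruhat_minimal (d : 'I_s -> nat) (v : {perm 'I_n}) : Prop :=
  forall x : {perm 'I_n}, piB d x = piB d v -> bruhat_le x v -> x = v.

Definition Qpoly (d : 'I_s -> nat) (u v : {perm 'I_n}) : set 'rV[R]_n :=
  conv [set piB d x | x in [set x | bruhat_le u x /\ bruhat_le x v]].

Definition bruhat_subdivision (d : 'I_s -> nat) (mu : 'I_s -> {set 'I_n} -> \bar R) :
  Prop :=
  forall x : 'rV[R]_n, exists u v : {perm 'I_n},
    [/\ bruhat_le u v, bruhat_minimal d v & cell d mu x = Qpoly d u v].

(* P is the polytope of a flag positroid of rank d: there is a real     *)
(* flag L_{d_1} < ... < L_{d_s} (L_{d_j} = span of the first d_j rows   *)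
(* of A, these rows being linearly independent) whose Plücker           *)
(* coordinates can be chosen >= 0, and P = sum_j conv{e_B : p_B(L_{d_j}) != 0}. *)
Definition flag_positroid_polytope (d : 'I_s -> nat) (P : set 'rV[R]_n) : Prop :=
  exists A : nat -> 'I_n -> R,
    [/\ forall j : 'I_s,
          \rank (\matrix_(i < d j, k < n) A (nat_of_ord i) k) = d j,
        forall j : 'I_s, exists c : R, c != 0 /\
          forall B : {set 'I_n}, #|B| = d j -> 0 <= c * plR A B
      & P = msum (fun j => conv [set eB B | B in
               [set B : {set 'I_n} | #|B| = d j /\ plR A B != 0]])].

Definition flag_positroid_subdivision (d : 'I_s -> nat)
    (mu : 'I_s -> {set 'I_n} -> \bar R) : Prop :=
  forall x : 'rV[R]_n, flag_positroid_polytope d (cell d mu x).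

End Defs.

(* Main.v *)
(* Part 1. For a complete flag with non-negative Pluecker coordinates p, the alternating
   partial sums of the incidence relation of (S, T) are themselves non-negative: by the
   three-term relations, p(S l j) times a partial sum cut between l and j is a combination
   with non-negative coefficients of the same partial sums for (S j, T) and (S l, T).
   Every term p(S t) p(T \ t) is the sum of two consecutive partial sums, hence is bounded
   by the sum of its two neighbours; the inequality of valuations follows.

   Parts 2 and 3. If lambda_t is the minimum, some weight x makes the cell of x contain,
   in the two constituents at hand, only bases S t' and T \ t' with lambda_t' minimal, and
   the basis S t and T \ t among them; since S is contained in T, such an x can be written
   down explicitly. A flag polytope determines its constituents, so in part 3 the signs of
   the Pluecker relation of the positroid flag give a second minimum of opposite parity.
   In part 2, writing D for the difference of the rank functions of v and u, the presence
   in [u, v] of permutations with high and with low values at t forces D > 0 at all middle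
   heights next to t on one side. A step upwards in [u, v] that exchanges the value at the
   next position of T \ S with a smaller (or larger) one can then be iterated until this
   value leaves the middle range. *)

From HB Require Import structures.
Require Import Defs.
From mathcomp Require Import all_boot all_order all_algebra all_fingroup.
From mathcomp Require Import ring lra zify.

Set Implicit Arguments.
Unset Strict Implicit.
Unset Printing Implicit Defensive.

Import Order.TTheory GRing.Theory Num.Theory.
Local Open Scope ring_scope.

(** * Pluecker relations for minors *)

(** The induction behind the partial sums enlarges [S] by one element at a time, so it passes
    through ranks that need not occur among the [d j]; hence Part 1 works with the coordinates of a
    complete flag. The division by p(S l j) is impossible when all these coordinates vanish across
    the cut. In that case basis extension and a three-term relation leave only sums that are zero or
    consist of one non-negative term. For the weight x, the coordinate of [t] in T \ S is confined
    between two exchange costs. This interval is non-empty because lambda_t is at least the minimum,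
    and it is a point only when both are equal. The exchange property reduces global optimality to
    single swaps. In Part 2 every permutation in [u, v] is high on S and at one element of T \ S,
    low off T and at one element of T \ S. So an element of T \ S whose value leaves the middle
    range at some point of [u, v] has minimal lambda, and it remains to move a neighbour of t that
    far without leaving the interval. *)

Section Plucker.
Variables (K : comNzRingType) (n : nat).
Implicit Types (A : nat -> 'I_n -> K) (B S T : {set 'I_n}) (t : 'I_n).

(** Only the first [#|B|] rows enter, so one function on subsets of all sizes records the
    coordinates of every member of the flag. It serves both real matrices and matrices of series. *)
Definition minor A B : K :=
  \det (\matrix_(i < #|B|, k < #|B|) A (nat_of_ord i) (@enum_val _ (mem B) k)).

Definition below B (m : nat) : nat := #|[set k : 'I_n in B | (k < m)%N]|.

Lemma minorE (x0 : 'I_n) d A B : #|B| = d ->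
  minor A B = \det (\matrix_(i < d, k < d) A i (nth x0 (enum B) k)).
Proof.
move=> <-; congr (\det _); apply/matrixP => i k; rewrite !mxE.
by rewrite (enum_val_nth x0).
Qed.

Lemma nth_rem (X : eqType) (x0 : X) (s : seq X) k j : uniq s ->
  (k < size s)%N -> nth x0 (rem (nth x0 s k) s) j = nth x0 s (bump k j).
Proof.
elim: s k j => [|x s IH] [|k] j //= /andP[xs us].
  by rewrite eqxx.
rewrite ltnS => ks; case: eqP => [e|_]; first by rewrite e mem_nth in xs.
by case: j => [|j] /=; [|rewrite IH // bumpS].
Qed.

Lemma enum_setD1 B t : enum (B :\ t) = rem t (enum B).
Proof.
rewrite rem_filter ?enum_uniq // -filter_predI.
by apply: eq_filter => k /=; rewrite !inE andbC.
Qed.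

Lemma index_below B t : t \in B -> index t (enum B) = below B t.
Proof.
move=> tB; rewrite /below cardE.
have -> : enum [set k : 'I_n in B | (k < t)%N] = [seq k : 'I_n <- enum B | (k < t)%N].
  rewrite /enum_mem -filter_predI; apply: eq_filter => k /=.
  by rewrite !inE andbC.
have : sorted (fun i j : 'I_n => (i < j)%N) (enum B).
  apply: sorted_filter; first by move=> a b c; apply: ltn_trans.
  rewrite -enumT -(map_id (enum 'I_n)).
  have := iota_ltn_sorted 0 n; rewrite -val_enum_ord sorted_map.
  by rewrite map_id.
have : t \in enum B by rewrite mem_enum.
elim: (enum B) => [//|x s IH]; rewrite inE /= => ts.
rewrite (path_sortedE (leT := fun i j : 'I_n => (i < j)%N)); last first.
  by move=> a b c; apply: ltn_trans.
case/andP=> /allP xs ss; case: (eqVneq t x) ts => [->|xt] /= ts.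
  rewrite ltnn; apply/esym/eqP.
  rewrite size_eq0 -[_ == _]negbK -has_filter.
  by apply/hasPn => y /xs; rewrite -leqNgt => /ltnW.
by rewrite xs //= IH.
Qed.

Lemma sum_enum (x0 : 'I_n) d B (F : 'I_n -> K) : #|B| = d ->
  \sum_(t in B) F t = \sum_(k < d) F (nth x0 (enum B) k).
Proof.
move=> Bd; rewrite -big_enum /= (big_nth x0) -cardE Bd big_mkord.
by [].
Qed.

Lemma cofactor_lastrow x0 r A T (k : 'I_r.+1) : #|T| = r.+1 ->
  cofactor (\matrix_(i < r.+1, k < r.+1) A i (nth x0 (enum T) k)) ord_max k =
  (-1) ^+ (r + k) * minor A (T :\ nth x0 (enum T) k).
Proof.
move=> Tr; have kT : (k < size (enum T))%N by rewrite -cardE Tr.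
have tT : nth x0 (enum T) k \in T by rewrite -mem_enum mem_nth.
rewrite /cofactor (@minorE x0 r); last first.
  by have := cardsD1 (nth x0 (enum T) k) T; rewrite tT Tr => -[].
congr (_ * \det _); apply/matrixP => a b.
by rewrite !mxE enum_setD1 nth_rem ?enum_uniq // lift_max.
Qed.

(** Up to sign, the expansion of a determinant whose last row repeats row [i]: an off-diagonal entry
    of the product of a matrix and its adjugate. *)
Lemma minor_lastrow A T i : (i.+1 < #|T|)%N ->
  \sum_(t in T) (-1) ^+ below T t * A i t * minor A (T :\ t) = 0.
Proof.
move=> iT; have [x0 _] : exists x0, x0 \in T.
  by apply/card_gt0P; apply: leq_trans iT.
case: {2 3}#|T| (erefl #|T|) iT => [//|r] Tr; rewrite ltnS => ir.
set M := \matrix_(i < r.+1, k < r.+1) A i (nth x0 (enum T) k).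
have := congr1 (fun N : 'M_r.+1 => N (widen_ord (leqnSn r) (Ordinal ir)) ord_max)
          (mul_mx_adj M).
rewrite /= !mxE.
have -> : widen_ord (leqnSn r) (Ordinal ir) == ord_max = false.
  by apply/negbTE/eqP => /(congr1 val) /= e; rewrite e ltnn in ir.
rewrite mulr0n => E; apply: (can_inj (signrMK r)).
rewrite mulr0 -[RHS]E mulr_sumr (sum_enum x0 _ Tr); apply: eq_bigr => k _.
rewrite !mxE /= cofactor_lastrow // -index_below; last first.
  by rewrite -mem_enum mem_nth // -cardE Tr.
rewrite index_uniq ?enum_uniq // -?cardE ?Tr // exprD -!mulrA.
by rewrite [in RHS]mulrCA; congr (_ * _); rewrite mulrCA.
Qed.

(** Put column [t] in front of the columns of [S] and expand along it: the coefficients do not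
    depend on [t]. For [t] in [S] a column is repeated; otherwise moving [t] to its place in
    [t |: S] costs the sign. *)
Lemma minor_column A S : exists c : nat -> K, forall t,
  \sum_(i < #|S|.+1) c i * A i t =
  if t \in S then 0 else (-1) ^+ below S t * minor A (t |: S).
Proof.
set d := #|S|.
pose mu i := if insub i is Some i' then
    \det (\matrix_(a < d, b < d) A (lift (i' : 'I_d.+1) a) (enum_val b)) else 0.
exists (fun i => (-1) ^+ i * mu i) => t.
pose M := \matrix_(i < d.+1, k < d.+1) A i (nth t (t :: enum S) k).
have -> : \sum_(i < d.+1) (-1) ^+ i * mu i * A i t = \det M.
  rewrite (expand_det_col M ord0); apply: eq_bigr => i _.
  rewrite !mxE /= /cofactor addn0 mulrC; congr (_ * (_ * _)).
  rewrite /mu insubT // => p; congr (\det _); apply/matrixP => a b; rewrite !mxE.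
  by rewrite (enum_val_nth t) /=; congr (A _ _); rewrite /bump /=.
case: ifPn => tS.
  have jS : (index t (enum S) < d)%N by rewrite /d cardE index_mem mem_enum.
  rewrite -det_tr (@determinant_alternate _ _ _ ord0 (lift ord0 (Ordinal jS))) //.
  by move=> k; rewrite !mxE /= nth_index ?mem_enum.
have dtS : #|t |: S| = d.+1 by rewrite cardsU1 tS.
rewrite (minorE t _ dtS).
set N := (X in _ * \det X).
have kS : (below S t < d.+1)%N.
  by rewrite ltnS subset_leq_card //; apply/fintype.subsetP => k; rewrite !inE => /andP[].
have ind : index t (enum (t |: S)) = below S t.
  rewrite index_below ?setU11 //; apply: eq_card => k; rewrite !inE.
  by case: eqP => [->|//]; rewrite ltnn /= andbF.
rewrite (expand_det_col N (Ordinal kS)) (expand_det_col M ord0) mulr_sumr.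
have Nt : nth t (enum (t |: S)) (below S t) = t.
  by rewrite -ind nth_index ?mem_enum ?setU11.
apply: eq_bigr => i _; rewrite !mxE /= Nt /cofactor /= addn0 exprD.
have -> : row' i (col' ord0 M) = row' i (col' (Ordinal kS) N).
  apply/matrixP => a b; rewrite !mxE /=; congr (A _ _).
  have -> : enum S = rem (nth t (enum (t |: S)) (below S t)) (enum (t |: S)).
    by rewrite Nt -enum_setD1 setU1K.
  rewrite nth_rem ?enum_uniq //.
  by rewrite -ind index_mem mem_enum setU11.
rewrite [RHS]mulrCA; congr (_ * _).
by rewrite [_ * (-1) ^+ below S t]mulrC -mulrA signrMK.
Qed.

(** Writing the minors of [t |: S] by [minor_column] makes the sum a combination, over the first
    [#|S|.+1] rows, of the sums that vanish by [minor_lastrow]. *)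
Lemma plucker_relation A S T : (#|S|.+1 < #|T|)%N ->
  \sum_(t in T :\: S) (-1) ^+ (below T t + below S t) *
     (minor A (t |: S) * minor A (T :\ t)) = 0.
Proof.
move=> ST; have [c cE] := minor_column A S.
transitivity (\sum_(t in T) (-1) ^+ below T t *
   (\sum_(i < #|S|.+1) c i * A i t) * minor A (T :\ t)).
  rewrite [RHS](bigID (fun t => t \in S)) /= [X in _ = X + _]big1 => [|t /andP[_ tS]].
    rewrite add0r; apply: eq_big => [t|t]; first by rewrite inE andbC.
    by rewrite inE cE => /andP[/negbTE-> _]; rewrite exprD !mulrA.
  by rewrite cE tS mulr0 mul0r.
transitivity (\sum_(t in T) \sum_(i < #|S|.+1)
   c i * ((-1) ^+ below T t * A i t * minor A (T :\ t))).
  apply: eq_bigr => t _; rewrite -mulrA mulr_suml mulr_sumr.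
  by apply: eq_bigr => i _; rewrite -!mulrA mulrCA.
rewrite exchange_big big1 //= => i _.
by rewrite -mulr_sumr minor_lastrow ?mulr0 // (leq_ltn_trans _ ST).
Qed.

Lemma minor_descend A B : (0 < #|B|)%N -> minor A B != 0 ->
  exists2 t, t \in B & minor A (B :\ t) != 0.
Proof.
move=> B0 Bn0; apply/exists_inP; apply: contraNT Bn0.
rewrite negb_exists_in => /forall_inP B1; have [x0 _] := card_gt0P B0.
case: {2}#|B| (erefl #|B|) B0 => [->//|r] Br _.
rewrite (minorE x0 _ Br) (expand_det_row _ ord_max) big1 // => k _.
rewrite cofactor_lastrow // (eqP (negbNE (B1 _ _))) ?mulr0 //.
by rewrite -mem_enum mem_nth // -cardE Br.
Qed.

End Plucker.

(** * Totally non-negative Pluecker vectors *)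

Section Adjacency.
Variable n : nat.
Implicit Types (U : {set 'I_n}) (a b t : 'I_n).

Definition adjacent U a b : Prop :=
  [/\ a \in U, b \in U, (a < b)%N & forall k, k \in U -> ~~ (a < k < b)%N].

Lemma adjacent_pred U t a : t \in U -> a \in U -> (a < t)%N ->
  exists b, adjacent U b t.
Proof.
move=> tU aU at_.
have Pa : (a \in U) && (a < t)%N by rewrite aU.
case: (@arg_maxnP _ a (fun k => (k \in U) && (k < t)%N) (@nat_of_ord n) Pa).
move=> b /andP[bU bt] bmax; exists b; split=> // k kU; apply/negP => /andP[bk kt].
have := bmax k; rewrite kU kt => /(_ isT); lia.
Qed.

Lemma adjacent_succ U t a : t \in U -> a \in U -> (t < a)%N ->
  exists b, adjacent U t b.
Proof.
move=> tU aU at_.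
have Pa : (a \in U) && (t < a)%N by rewrite aU.
case: (@arg_minnP _ a (fun k => (k \in U) && (t < k)%N) (@nat_of_ord n) Pa).
move=> b /andP[bU bt] bmin; exists b; split=> // k kU; apply/negP => /andP[bk kt].
have := bmin k; rewrite kU bk => /(_ isT); lia.
Qed.
End Adjacency.

Section PluckerVector.
Variables (K : realDomainType) (n : nat) (p : {set 'I_n} -> K).
Implicit Types (B C S T U : {set 'I_n}) (t i j l : 'I_n).

Definition plucker_vector : Prop := forall S T, (#|S|.+1 < #|T|)%N ->
  \sum_(t in T :\: S) (-1) ^+ (below T t + below S t) * (p (t |: S) * p (T :\ t)) = 0.

Hypothesis pP : plucker_vector.

(** A vanishing sum cannot have exactly one non-zero term. This is basis exchange, also between
    bases of different ranks. *)
Lemma plucker_exchange S T t : (#|S|.+1 < #|T|)%N -> t \in T :\: S ->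
  p (t |: S) != 0 -> p (T :\ t) != 0 ->
  exists t', [/\ t' \in T :\: S, t' != t, p (t' |: S) != 0 & p (T :\ t') != 0].
Proof.
move=> ST tTS n1 n2.
case: (boolP [exists t' in T :\: S, [&& t' != t, p (t' |: S) != 0 & p (T :\ t') != 0]]).
  by case/exists_inP => t' h /and3P[]; exists t'.
rewrite negb_exists_in => /forall_inP h; have := pP ST.
rewrite (bigD1 t) //= big1 => [|t' /andP[t'U t't]].
  move/eqP; rewrite addr0 mulf_eq0 signr_eq0 /= mulf_eq0.
  by rewrite (negbTE n1) (negbTE n2).
have := h _ t'U; rewrite t't /= negb_and !negbK => /orP[]/eqP->.
  by rewrite mul0r mulr0.
by rewrite !mulr0.
Qed.

Lemma below_setD S T t : S \subset T ->
  below T t = (below S t + below (T :\: S) t)%N.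
Proof.
move=> ST; rewrite /below -(cardsID S [set k : 'I_n in T | (k < t)%N]).
congr (_ + _)%N; apply: eq_card => k; rewrite !inE; case: (boolP (k \in S)) => kS;
  by rewrite ?(fintype.subsetP ST _ kS) ?andbT ?andbF.
Qed.

(** For [S] inside [T] the two counts in the sign share the elements of [S] twice, so the signs
    simply alternate along [T :\: S]. *)
Lemma plucker_sub S T : S \subset T -> (#|S|.+1 < #|T|)%N ->
  \sum_(t in T :\: S) (-1) ^+ below (T :\: S) t * (p (t |: S) * p (T :\ t)) = 0.
Proof.
move=> sST ST; rewrite -[RHS](pP ST); apply: eq_bigr => t _.
rewrite (below_setD t sST) addnAC addnn exprD -mul2n exprM sqrrN.
by rewrite !expr1n mul1r.
Qed.

Lemma three_term S a b c : a \notin S -> b \notin S -> c \notin S ->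
  (a < b)%N -> (b < c)%N ->
  p (b |: S) * p (a |: (c |: S)) =
  p (a |: S) * p (b |: (c |: S)) + p (c |: S) * p (a |: (b |: S)).
Proof.
move=> aS bS cS ab bc.
have ab' : a != b by apply/eqP => e; rewrite e ltnn in ab.
have bc' : b != c by apply/eqP => e; rewrite e ltnn in bc.
have ac' : a != c by apply/eqP => e; move: (ltn_trans ab bc); rewrite e ltnn.
set T := a |: (b |: (c |: S)).
have TS : T :\: S = a |: (b |: [set c]).
  apply/setP => k; rewrite !inE; case: (boolP (k \in S)) => kS; rewrite ?andbF ?orbF //.
  by apply/esym/negbTE; rewrite !negb_or; apply/and3P; split;
    apply: contraTneq kS => ->.
have sST : S \subset T by apply/fintype.subsetP => k kS; rewrite !inE kS !orbT.
have cT : (#|S|.+1 < #|T|)%N.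
  by rewrite /T !cardsU1 !inE (negbTE aS) (negbTE bS) cS (negbTE ab') (negbTE bc') (negbTE ac').
have := plucker_sub sST cT.
have ma : a \notin b |: [set c] by rewrite !inE negb_or ab' ac'.
have mb : b \notin [set c] by rewrite inE.
rewrite TS big_setU1 // big_setU1 // big_set1.
have -> : below (a |: (b |: [set c])) a = 0%N.
  apply: eq_card0 => k; rewrite !inE; apply/negbTE/negP => /andP[/or3P[]/eqP->];
    by rewrite ?ltnn // ltnNge ltnW // (ltn_trans ab).
have -> : below (a |: (b |: [set c])) b = 1%N.
  rewrite /below -(cards1 a); apply: eq_card => k; rewrite !inE.
  case: (eqVneq k a) => [->|_] //=; apply/negbTE/negP => /andP[/orP[]/eqP->];
    by rewrite ?ltnn // ltnNge ltnW.
have -> : below (a |: (b |: [set c])) c = 2%N.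
  rewrite /below -[RHS](_ : #|[set a; b]| = 2%N); last by rewrite cards2 ab'.
  apply: eq_card => k; rewrite !inE.
  case: (eqVneq k a) => [->|_] //=; first by rewrite (ltn_trans ab).
  by case: (eqVneq k b) => [->|_] //=; case: eqP => [->|//]; rewrite ltnn.
have -> : T :\ a = b |: (c |: S).
  by rewrite /T setU1K // !inE !negb_or ab' ac'.
have -> : T :\ b = a |: (c |: S).
  by rewrite /T setUCA setU1K // !inE !negb_or eq_sym ab' bc'.
have -> : T :\ c = a |: (b |: S).
  rewrite /T (setUCA [set b]) setUCA setU1K // !inE !negb_or.
  by rewrite eq_sym ac' eq_sym bc'.
move=> E; rewrite -[LHS]addr0 -E /=; ring.
Qed.

Hypothesis p_rank : forall m, (m <= n)%N -> exists2 B : {set 'I_n}, #|B| = m & p B != 0.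

Lemma basis_extend C T l : C \subset T -> l \in T -> (#|C|.+1 < #|T|)%N ->
  p C != 0 -> p (T :\ l) != 0 -> exists2 z, z \in T :\: C & p (z |: C) != 0.
Proof.
move=> CT lT cCT pC pT.
have [B0 cB0 pB0] : exists2 B : {set 'I_n}, #|B| = #|C|.+1 & p B != 0.
  by apply: p_rank; rewrite (leq_trans (ltnW cCT)) // -[leqRHS]card_ord max_card.
pose Q1 B := (#|B| == #|C|.+1) && (p B != 0).
have Q10 : Q1 B0 by rewrite /Q1 cB0 eqxx.
(* A basis of the next rank missing as little of [C] as possible contains [C]: otherwise exchange
   against [C] brings in a missing [u] and drops an element outside [C]. *)
case: (@arg_minnP _ B0 Q1 (fun B => #|C :\: B|) Q10) => B1 /andP[/eqP cB1 pB1] min1.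
have CB1 : C \subset B1.
  rewrite -setD_eq0; apply/set0Pn => -[u uCB]; move: (uCB); rewrite inE => /andP[uB uC].
  have cS : #|C :\ u|.+1 = #|C| by have := cardsD1 u C; rewrite uC.
  have [||||t [tTS tu _ pt]] := @plucker_exchange (C :\ u) (u |: B1) u.
  - by rewrite cS cardsU1 uB cB1.
  - by rewrite !inE eqxx.
  - by rewrite setD1K.
  - by rewrite setU1K.
  move: tTS; rewrite !inE negb_and negbK (negbTE tu) /= => /andP[tC tB].
  have := min1 ((u |: B1) :\ t).
  rewrite /Q1 pt (_ : #|_| == _); last first.
    have := cardsD1 t (u |: B1); rewrite !inE tB orbT cardsU1 uB cB1 /= => h.
    by move/addnI: h => <-.
  move=> /(_ isT); apply/negP; rewrite -ltnNge; apply: proper_card.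
  apply/properP; split; last by exists u => //; rewrite !inE uC eqxx eq_sym tu.
  apply/fintype.subsetP => k; rewrite !inE !negb_and !negb_or !negbK.
  case/andP=> h kC; rewrite kC andbT; case/orP: h => [/eqP e|/andP[]//].
  by rewrite e (negbTE tC) in kC.
pose Q2 B := [&& #|B| == #|C|.+1, p B != 0 & C \subset B].
have Q20 : Q2 B1 by rewrite /Q2 cB1 eqxx pB1.
(* Among those containing [C], one with fewest elements outside [T] lies in [T]: exchange against
   [T :\ l] replaces an outside [y] by an element of [T]. The element of [B] outside [C] is the
   required one. *)
case: (@arg_minnP _ B1 Q2 (fun B => #|B :\: T|) Q20) => B /and3P[/eqP cB pB CB] min2.
have BT : B \subset T.
  rewrite -setD_eq0; apply/set0Pn => -[y]; rewrite inE => /andP[yT yB].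
  have yC : y \notin C by apply: contra yT; apply: (fintype.subsetP CT).
  have cS : #|B :\ y|.+1 = #|B| by have := cardsD1 y B; rewrite yB.
  have cTl : #|T :\ l|.+1 = #|T| by have := cardsD1 l T; rewrite lT.
  have yTl : y \notin T :\ l by rewrite !inE negb_and yT orbT.
  have [||||t [tTS ty pt _]] := @plucker_exchange (B :\ y) (y |: (T :\ l)) y.
  - by rewrite cS cB cardsU1 yTl add1n cTl.
  - by rewrite !inE eqxx.
  - by rewrite setD1K.
  - by rewrite setU1K.
  move: tTS; rewrite !inE ty (negbTE ty) /= => /andP[tB /andP[tl tT]].
  have := min2 (t |: B :\ y).
  rewrite /Q2 pt cardsU1 !inE ty (negbTE tB) /= add1n cS cB eqxx /=.
  have -> : C \subset t |: B :\ y.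
    apply/fintype.subsetP => k kC; rewrite !inE (fintype.subsetP CB) // andbT.
    by apply/orP; right; apply: contraNneq yC => <-.
  move=> /(_ isT); apply/negP; rewrite -ltnNge; apply: proper_card.
  apply/properP; split; last by exists y; rewrite !inE ?yT ?yB // eqxx eq_sym (negbTE ty).
  apply/fintype.subsetP => k; rewrite !inE => /andP[kT /orP[/eqP e|/andP[_ ->]]].
    by rewrite e tT in kT.
  by rewrite kT.
have [z zBC] : exists z, z \in B :\: C.
  apply/set0Pn; rewrite setD_eq0; apply/negP => /subset_leq_card.
  by rewrite cB ltnn.
exists z; first by rewrite !inE in zBC *; case/andP: zBC => -> /(fintype.subsetP BT).
have <- // : B = z |: C; apply/esym/eqP; rewrite eqEcard.
rewrite !inE in zBC; case/andP: zBC => zC zB.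
by rewrite finset.subUset sub1set zB CB /= cardsU1 zC cB.
Qed.

Hypothesis p_ge0 : forall B, 0 <= p B.

(* The sign is normalised so that the term of the last index below [m] is positive. *)
Definition partial_sum S T (m : nat) : K :=
  \sum_(i in T :\: S | (i < m)%N)
    (-1) ^+ (below (T :\: S) i + below (T :\: S) m).+1 * (p (i |: S) * p (T :\ i)).

Lemma below_setD1 U l m : l \in U -> below U m = (below (U :\ l) m + (l < m))%N.
Proof.
move=> lU; rewrite /below (cardsD1 l) inE lU addnC; congr (_ + _)%N.
  by apply: eq_card => k; rewrite !inE andbA.
Qed.

(** Holds term by term: the coefficients of [p (T :\ i)] satisfy the three-term relation for [i],
    [l], [j]. Removing [j], beyond the cut, changes no sign; removing [l] flips the sign exactly
    when [i < l], which matches the order in which [i] and [l] enter that relation. *)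
Lemma partial_sum_step S T l j m : S \subset T ->
  l \in T :\: S -> j \in T :\: S -> (l < m)%N -> (m <= j)%N ->
  partial_sum S T m * p (l |: (j |: S)) =
  p (l |: S) * partial_sum (j |: S) T m + p (j |: S) * partial_sum (l |: S) T m.
Proof.
move=> sST lU jU lm mj; rewrite /partial_sum mulr_suml !mulr_sumr.
have Uj : T :\: (j |: S) = (T :\: S) :\ j by rewrite setUC setDDl.
have Ul : T :\: (l |: S) = (T :\: S) :\ l by rewrite setUC setDDl.
rewrite Uj Ul; set U := T :\: S in lU jU *.
have lS : l \notin S by move: lU; rewrite inE => /andP[].
have jS : j \notin S by move: jU; rewrite inE => /andP[].
have -> : forall F, \sum_(i in U :\ j | (i < m)%N) F i = \sum_(i in U | (i < m)%N) F i :> K.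
  move=> F; apply: eq_bigl => i; rewrite !inE; case: eqP => [->|//].
  by rewrite ltnNge mj /= !andbF.
have -> : forall F, \sum_(i in U :\ l | (i < m)%N) F i =
   \sum_(i in U | (i < m)%N) (if i == l then 0 else F i) :> K.
  move=> F; rewrite [LHS]big_mkcond [RHS]big_mkcond; apply: eq_bigr => i _.
  by rewrite !inE; case: eqP => //= _; case: ifP.
rewrite -big_split; apply: eq_bigr => i /andP[iU im] /=.
have ij : (i < j)%N by apply: leq_trans mj.
have iS : i \notin S by move: iU; rewrite inE => /andP[].
have -> : below (U :\ j) i = below U i by rewrite (below_setD1 i jU) ltnNge (ltnW ij) addn0.
have -> : below (U :\ j) m = below U m by rewrite (below_setD1 m jU) ltnNge mj addn0.
case: (eqVneq i l) => [->|il]; first by rewrite addr0; ring.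
rewrite (below_setD1 i lU) (below_setD1 m lU) lm.
case: (ltngtP i l) => [ltil|ltli|/val_inj e]; last by rewrite e eqxx in il.
  have E := @three_term S i l j iS lS jS ltil (leq_trans lm mj).
  rewrite addn0 addn1 addnS; set e := (_ + _).+1.
  rewrite [_ ^+ e.+1]exprS mulN1r; apply/eqP; rewrite -subr_eq0; apply/eqP.
  transitivity ((-1) ^+ e * p (T :\ i) * (p (l |: S) * p (i |: (j |: S)) -
    (p (i |: S) * p (l |: (j |: S)) + p (j |: S) * p (i |: (l |: S))))); first by ring.
  by rewrite E subrr mulr0.
have E := @three_term S l i j lS iS jS ltli ij.
rewrite !addn1 addSn addnS -addn2 exprD sqrrN expr1n mulr1; set e := (_ + _).+1.
apply/eqP; rewrite -subr_eq0; apply/eqP.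
transitivity ((-1) ^+ e * p (T :\ i) * (p (i |: S) * p (l |: (j |: S)) -
    (p (l |: S) * p (i |: (j |: S)) + p (j |: S) * p (i |: (l |: S))))); first by ring.
by rewrite E [l |: (i |: S)]setUCA subrr mulr0.
Qed.

Lemma partial_sum_eq0 S T m : S \subset T -> (#|S|.+1 < #|T|)%N ->
  (forall j, j \in T :\: S -> (m <= j)%N -> p (j |: S) * p (T :\ j) = 0) ->
  partial_sum S T m = 0.
Proof.
move=> sST ST h; rewrite /partial_sum.
transitivity ((-1) ^+ (below (T :\: S) m).+1 * \sum_(i in T :\: S | (i < m)%N)
    (-1) ^+ below (T :\: S) i * (p (i |: S) * p (T :\ i))).
  rewrite mulr_sumr; apply: eq_bigr => i _.
  by rewrite -addnS exprD -mulrA mulrCA.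
have := plucker_sub sST ST.
rewrite (bigID (fun i : 'I_n => (i < m)%N)) /= [X in _ + X]big1 => [|i].
  by rewrite addr0 => ->; rewrite mulr0.
by rewrite -leqNgt => /andP[iU mi]; rewrite h // mulr0.
Qed.

(** Induction on the size of [T :\: S]: [partial_sum_step] reduces to larger [S] as soon as one
    coordinate [p (l |: (j |: S))] with [l] below and [j] beyond the cut is non-zero. The rest
    treats the case where all of them vanish. *)
Lemma partial_sum_ge0 S T m : S \subset T -> 0 <= partial_sum S T m.
Proof.
move: {2}#|T :\: S| (leqnn #|T :\: S|) => k; elim: k S m => [|k IH] S m Uk sST.
  rewrite /partial_sum big_pred0 // => i.
  by move: Uk; rewrite leqn0 cards_eq0 => /eqP->; rewrite inE.
set U := T :\: S in Uk.
have contract i : i \in U -> (#|T :\: (i |: S)| <= k)%N /\ (i |: S \subset T).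
  move=> iU; move: (iU); rewrite !inE => /andP[iS iT].
  rewrite finset.subUset sub1set iT sST; split=> //.
  by rewrite setUC -setDDl; move: Uk; rewrite (cardsD1 i U) iU.
case: (boolP [exists l in U, exists j in U, (l < m <= j)%N && (p (l |: (j |: S)) != 0)]).
  case/exists_inP => l lU /exists_inP[j jU /andP[/andP[lm mj] plj]].
  have plj0 : 0 < p (l |: (j |: S)) by rewrite lt_def plj p_ge0.
  rewrite -(pmulr_lge0 _ plj0) partial_sum_step // addr_ge0 // mulr_ge0 //.
    by apply: IH; have [] := contract _ jU.
  by apply: IH; have [] := contract _ lU.
rewrite negb_exists_in => /forall_inP cross.
have {}cross l j : l \in U -> j \in U -> (l < m <= j)%N -> p (l |: (j |: S)) = 0.
  move=> lU jU lmj; have := cross _ lU; rewrite negb_exists_in => /forall_inP/(_ _ jU).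
  by rewrite lmj negbK => /eqP.
case: (boolP [exists i in U, (i < m)%N && (p (i |: S) * p (T :\ i) != 0)]); last first.
  rewrite negb_exists_in => /forall_inP h; rewrite /partial_sum big1 // => i /andP[iU im].
  by have := h _ iU; rewrite im negbK => /eqP->; rewrite mulr0.
case/exists_inP => i iU /andP[im ni].
(* With no non-zero term beyond the cut, the partial sum is the whole relation up to sign, hence
   zero; if [T :\: S] is too small for a relation, it is a single term, with positive sign. *)
case: (boolP [exists j in U, (m <= j)%N && (p (j |: S) * p (T :\ j) != 0)]); last first.
  rewrite negb_exists_in => /forall_inP h; case: (ltnP #|S|.+1 #|T|) => ST.
    rewrite partial_sum_eq0 // => j jU mj.
    by have := h _ jU; rewrite mj negbK => /eqP.
  have U1 : U = [set i].
    apply/esym/eqP; rewrite eqEcard sub1set iU cards1 /U cardsD (setIidPr sST).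
    by rewrite leq_subLR addn1.
  rewrite /partial_sum -/U (big_pred1 i) => [|x]; last first.
    by rewrite U1 !inE; case: eqP => [->|].
  have -> : below U i = 0%N.
    by rewrite /below U1; apply: eq_card0 => x; rewrite !inE; case: eqP => [->|//]; rewrite ltnn.
  have -> : below U m = 1%N.
    rewrite /below U1 -(cards1 i); apply: eq_card => x; rewrite !inE.
    by case: eqP => [->|].
  by rewrite add0n sqrrN expr1n mul1r mulr_ge0.
case/exists_inP => j jU /andP[mj nj].
have ij : (i < j)%N by apply: leq_trans mj.
have [iS iT] : i \notin S /\ i \in T by move: iU; rewrite inE => /andP[].
have [jS jT] : j \notin S /\ j \in T by move: jU; rewrite inE => /andP[].
move: ni nj; rewrite !mulf_eq0 !negb_or => /andP[pi pTi] /andP[pj pTj].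
have ij' : i != j by apply/eqP => e; rewrite e ltnn in ij.
(* There are non-zero terms at [i] below and at [j] beyond the cut. If [T :\: S] is just these two,
   only the term of [i] is summed, with positive sign. *)
case: (ltnP #|S|.+2 #|T|) => ST; last first.
  have U2 : U = [set i; j].
    apply/esym/eqP; rewrite eqEcard finset.subUset !sub1set iU jU cards2 ij' /U.
    by rewrite cardsD (setIidPr sST) leq_subLR addn2.
  rewrite /partial_sum -/U (big_pred1 i) => [|x]; last first.
    rewrite U2 !inE; case: (eqVneq x i) => [->|_] //=.
    by case: eqP => [->|//]; rewrite ltnNge mj.
  have -> : below U i = 0%N.
    rewrite /below U2; apply: eq_card0 => x; rewrite !inE.
    case: (eqVneq x i) => [->|_] /=; first by rewrite ltnn.
    by case: eqP => [->|//]; rewrite ltnNge (ltnW ij).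
  have -> : below U m = 1%N.
    rewrite /below U2 -(cards1 i); apply: eq_card => x; rewrite !inE.
    case: (eqVneq x i) => [->|_] //=.
    by case: eqP => [->|//]; rewrite ltnNge mj.
  by rewrite add0n sqrrN expr1n mul1r mulr_ge0.
(* Otherwise extend [i |: S] inside [T] by some [z]. As the cross coordinates vanish, [z] is below
   the cut; the three-term relation for [i], [z], [j] then has exactly one non-zero product, a
   contradiction. *)
have [||z] := @basis_extend (i |: S) T i _ iT _ pi pTi.
- by have [] := contract _ iU.
- by rewrite cardsU1 iS.
rewrite !inE negb_or => /andP[/andP[zi zS] zT] pz.
have zU : z \in U by rewrite inE zS.
case: (ltnP z m) => zm; last first.
  by move: pz; rewrite setUCA cross ?eqxx // im.
have zj : (z < j)%N by apply: leq_trans mj.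
have cij : p (i |: (j |: S)) = 0 by apply: cross => //; rewrite im.
have czj : p (z |: (j |: S)) = 0 by apply: cross => //; rewrite zm.
case: (ltngtP i z) => [iz|iz|/val_inj e]; last by rewrite e eqxx in zi.
  have := three_term iS zS jS iz zj; rewrite cij czj !mulr0 add0r => /esym/eqP.
  by rewrite mulf_eq0 (negbTE pj) setUCA (negbTE pz).
have := three_term zS iS jS iz ij; rewrite cij czj !mulr0 add0r => /esym/eqP.
by rewrite mulf_eq0 (negbTE pj) (negbTE pz).
Qed.

(** Moving the cut past [t] reverses the normalising sign, so all earlier terms cancel and the term
    of [t] remains. *)
Lemma partial_sumS S T t : t \in T :\: S ->
  partial_sum S T t + partial_sum S T t.+1 = p (t |: S) * p (T :\ t).
Proof.
set U := T :\: S => tU; rewrite /partial_sum -/U.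
have -> : below U t.+1 = (below U t).+1.
  rewrite /below (cardsD1 t) inE tU ltnSn add1n; congr _.+1; apply: eq_card => k.
  by rewrite !inE ltnS leq_eqVlt -val_eqE /=; case: ltngtP => //=; rewrite ?andbF.
rewrite [X in _ + X](bigD1 t) /=; last by rewrite tU ltnS leqnn.
have -> : forall G : 'I_n -> K, \sum_(i in U | (i < t)%N) G i =
    \sum_(i | (i \in U) && (i < t.+1)%N && (i != t)) G i.
  move=> G; apply: eq_bigl => i; rewrite -andbA ltnS -val_eqE /=; congr (_ && _).
  by case: ltngtP.
rewrite addrCA -big_split big1 /= => [|i _].
  by rewrite addr0 addnS addnn -doubleS -mul2n exprM sqrrN !expr1n mul1r.
by rewrite addnS [in X in _ + X]exprS mulN1r mulNr subrr.
Qed.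

Lemma partial_sum_eq S T m m' : (m <= m')%N ->
  (forall k, k \in T :\: S -> ~~ (m <= k < m')%N) ->
  partial_sum S T m = partial_sum S T m'.
Proof.
move=> mm' h.
have e (i : 'I_n) : i \in T :\: S -> (i < m)%N = (i < m')%N.
  by move=> /h; lia.
rewrite /partial_sum; have -> : below (T :\: S) m = below (T :\: S) m'.
  by apply: eq_card => k; rewrite !inE -in_setD; case: (boolP (k \in T :\: S)) => // /e.
by apply: eq_bigl => i; case: (boolP (i \in T :\: S)) => // /e.
Qed.

Let F S T t := p (t |: S) * p (T :\ t).

(* The two summands are the alternating partial sums of the Pluecker relation
   just below and just above [t]. *)
Lemma plucker_adjacent_split S T t : S \subset T -> (#|S|.+1 < #|T|)%N ->
  t \in T :\: S -> exists x y : K,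
  [/\ 0 <= x, 0 <= y, F S T t = x + y,
     x = 0 \/ exists2 a, adjacent (T :\: S) a t & x <= F S T a
   & y = 0 \/ exists2 a, adjacent (T :\: S) t a & y <= F S T a].
Proof.
move=> sST ST tU; exists (partial_sum S T t), (partial_sum S T t.+1).
rewrite !partial_sum_ge0 // /F -partial_sumS //; split=> //.
- case: (boolP [exists a in T :\: S, (a < t)%N]) => [/exists_inP[a aU at_]|].
    (* The cut just after the predecessor [b] is the cut just before [t], so the term of [b] is this
       partial sum plus another non-negative one. *)
    have [b bt] := adjacent_pred tU aU at_; right; exists b => //.
    have [bU _ ltbt no] := bt; rewrite /F -partial_sumS //.
    by rewrite -(@partial_sum_eq S T b.+1 t) // ler_wpDl ?partial_sum_ge0.
  rewrite negb_exists_in => /forall_inP h; left; rewrite /partial_sum.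
  by rewrite big_pred0 // => i; case: (boolP (i \in _)) => // /h/negbTE.
- case: (boolP [exists a in T :\: S, (t < a)%N]) => [/exists_inP[a aU at_]|].
    have [b bt] := adjacent_succ tU aU at_; right; exists b => //.
    have [_ bU ltbt no] := bt; rewrite /F -partial_sumS //.
    by rewrite -(@partial_sum_eq S T t.+1 b) // ler_wpDr ?partial_sum_ge0.
  rewrite negb_exists_in => /forall_inP h; left; rewrite partial_sum_eq0 // => j jU tj.
  by have := h _ jU; rewrite tj.
Qed.
End PluckerVector.

From mathcomp Require Import boolp classical_sets functions cardinality fsbigop.
From mathcomp Require Import reals constructive_ereal ereal.
From Stdlib Require Import Relations.

Local Open Scope classical_set_scope.
Local Open Scope ring_scope.

(** * The ordered ring of generalized Puiseux series *)

Section SeriesRing.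
Variable R : realType.
Implicit Types (f g h : series R) (a b c M : R).

Lemma gpuiseux_seq f M : gpuiseux f ->
  exists s : seq R, uniq s /\ forall a, f a != 0 -> a <= M -> a \in s.
Proof.
move=> /(_ M)/finite_seqP[s sE]; exists (undup s); split; first exact: undup_uniq.
move=> a fa aM; rewrite mem_undup.
by have : [set` s] a by rewrite -sE.
Qed.

(** Below any exponent [a0] of the support there are finitely many others; the least of them is the
    least of all. *)
Lemma gpuiseux_lead f : gpuiseux f -> f <> @zeroS R ->
  exists a, f a != 0 /\ forall b, b < a -> f b = 0.
Proof.
move=> gf f0; have [a0 fa0] : exists a0, f a0 != 0.
  apply: contrapT => h; apply: f0; apply: funext => a; apply/eqP.
  by apply: contrapT => /negP fa; apply: h; exists a.
have [s [us sP]] := gpuiseux_seq a0 gf.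
have a0s : a0 \in s by exact: sP.
pose i0 := Ordinal (etrans (index_mem a0 s) a0s).
have P0 : f (tnth (in_tuple s) i0) != 0.
  by rewrite (tnth_nth 0) /= nth_index.
case: (@arg_minP _ _ _ i0 (fun i => f (tnth (in_tuple s) i) != 0)
  (fun i => tnth (in_tuple s) i) P0) => i fi mini.
exists (tnth (in_tuple s) i); split=> // b bi; apply/eqP; apply: contraTT bi => fb.
rewrite -leNgt; case: (leP b a0) => ba0; last first.
  apply: ltW; apply: le_lt_trans ba0.
  by have := mini i0 P0; rewrite (tnth_nth 0 _ i0) /= nth_index.
have bs := sP b fb ba0.
have := mini (Ordinal (etrans (index_mem b s) bs)).
by rewrite (tnth_nth 0 _ (Ordinal _)) /= nth_index //; apply.
Qed.

Lemma gpuiseux_bounded f : gpuiseux f -> exists m, forall a, f a != 0 -> m <= a.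
Proof.
move=> gf; have [->|f0] := pselect (f = @zeroS R); first by exists 0 => a; rewrite eqxx.
have [m [_ fm]] := gpuiseux_lead gf f0; exists m => a fa.
by rewrite leNgt; apply: contraNN fa => /fm->.
Qed.

(** The list may be larger than the set of contributing exponents, so different products can be
    summed over a common list. *)
Lemma mulSE f g c (s : seq R) : uniq s ->
  (forall a, f a != 0 -> g (c - a) != 0 -> a \in s) ->
  mulS f g c = \sum_(a <- s) f a * g (c - a).
Proof.
move=> us sP; rewrite /mulS fsbig_mkcond [RHS]fsbig_seq // [RHS]fsbig_mkcond.
apply: eq_fsbigr => a _; rewrite /patch; case: ifPn => fa; case: ifPn => sa //.
- apply/eqP; rewrite mulf_eq0 -[_ || _]negbK negb_or; apply/negP => /andP[n1 n2].
  by move/negP: sa; apply; rewrite inE /=; apply: sP.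
- by move: fa; rewrite notin_setE /supp /= => /negP; rewrite negbK => /eqP->; rewrite mul0r.
Qed.

Lemma mulS_supp f g c : mulS f g c != 0 ->
  exists a, f a != 0 /\ g (c - a) != 0.
Proof.
move=> h; apply: contrapT => nh; move/negP: h; apply; apply/eqP.
rewrite (@mulSE _ _ _ [::]) ?big_nil // => a fa ga; case: nh; by exists a.
Qed.

Lemma mulS_seq f g c : gpuiseux f -> gpuiseux g ->
  exists s : seq R, uniq s /\ forall a, f a != 0 -> g (c - a) != 0 -> a \in s.
Proof.
move=> gf gg; have [m gm] := gpuiseux_bounded gg.
have [s [us sP]] := gpuiseux_seq (c - m) gf; exists s; split=> // a fa gca.
by apply: sP => //; have := gm _ gca; lra.
Qed.


Lemma gpuiseuxP f : (forall M, exists s : seq R, forall a, f a != 0 -> a <= M -> a \in s) ->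
  gpuiseux f.
Proof.
move=> h M; have [s sP] := h M; apply: (sub_finite_set _ (finite_seq s)).
by move=> a [fa aM]; apply: sP.
Qed.

Lemma gpuiseux_zero : gpuiseux (@zeroS R).
Proof. by apply: gpuiseuxP => M; exists [::] => a; rewrite eqxx. Qed.

Lemma gpuiseux_one : gpuiseux (@oneS R).
Proof.
apply: gpuiseuxP => M; exists [:: 0] => a; rewrite /oneS inE.
by case: ifP => // _; rewrite eqxx.
Qed.

Lemma gpuiseux_add f g : gpuiseux f -> gpuiseux g -> gpuiseux (addS f g).
Proof.
move=> gf gg; apply: gpuiseuxP => M.
have [s [_ sP]] := gpuiseux_seq M gf; have [s' [_ sP']] := gpuiseux_seq M gg.
exists (s ++ s') => a; rewrite /addS mem_cat => h aM.
case: (eqVneq (f a) 0) h => [->|fa] h; last by rewrite sP.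
by rewrite sP' ?orbT //; move: h; rewrite add0r.
Qed.

Lemma gpuiseux_scale r f : gpuiseux f -> gpuiseux (scaleS r f).
Proof.
move=> gf; apply: gpuiseuxP => M; have [s [_ sP]] := gpuiseux_seq M gf.
by exists s => a; rewrite /scaleS mulf_eq0 negb_or => /andP[_]; apply: sP.
Qed.

Lemma gpuiseux_mul f g : gpuiseux f -> gpuiseux g -> gpuiseux (mulS f g).
Proof.
move=> gf gg; apply: gpuiseuxP => M.
have [mf mfP] := gpuiseux_bounded gf; have [mg mgP] := gpuiseux_bounded gg.
have [s [_ sP]] := gpuiseux_seq (M - mg) gf.
have [s' [_ sP']] := gpuiseux_seq (M - mf) gg.
exists [seq a + b | a <- s, b <- s'] => c /mulS_supp[a [fa gca]] cM.
have := mfP _ fa; have := mgP _ gca => h1 h2.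
apply/allpairsP; exists (a, c - a); split=> /=.
- by apply: sP => //; lra.
- by apply: sP' => //; lra.
- by rewrite addrC subrK.
Qed.

Lemma mulSC f g : gpuiseux f -> gpuiseux g -> mulS f g = mulS g f.
Proof.
move=> gf gg; apply: funext => c; have [s [us sP]] := mulS_seq c gf gg.
rewrite (mulSE us sP) (@mulSE g f c [seq c - a | a <- s]).
- by rewrite big_map; apply: eq_bigr => a _; rewrite mulrC opprB addrCA subrr addr0.
- by rewrite map_inj_uniq // => a b /addrI/oppr_inj.
- move=> a ga fa; apply/mapP; exists (c - a); last by lra.
  by apply: sP => //; rewrite opprB addrCA subrr addr0.
Qed.

Lemma mulSA f g h : gpuiseux f -> gpuiseux g -> gpuiseux h ->
  mulS f (mulS g h) = mulS (mulS f g) h.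
Proof.
move=> gf gg gh; apply: funext => c.
have [mf mfP] := gpuiseux_bounded gf; have [mg mgP] := gpuiseux_bounded gg.
have [mh mhP] := gpuiseux_bounded gh.
(* Exponents of the three factors that add up to [c] are each bounded above by [c] minus lower
   bounds of the other two; [s3] collects the resulting exponents of the product of [f] and [g]. *)
have [s1 [us1 s1P]] := gpuiseux_seq (c - mg - mh) gf.
have [s2 [us2 s2P]] := gpuiseux_seq (c - mf - mh) gg.
pose s3 := undup [seq a + b | a <- s1, b <- s2].
have s3P a b : a \in s1 -> b \in s2 -> a + b \in s3.
  by move=> *; rewrite mem_undup; apply/allpairsP; exists (a, b).
rewrite (mulSE us1); last first.
  move=> a fa /mulS_supp[b [gb hb]]; apply: s1P => //.
  by have := mgP _ gb; have := mhP _ hb; lra.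
rewrite (@mulSE _ h c s3) ?undup_uniq //; last first.
  move=> e /mulS_supp[a [fa gea]] he.
  have := mfP _ fa; have := mgP _ gea; have := mhP _ he => h1 h2 h3.
  by rewrite -[e](subrK a) addrC; apply: s3P; [apply: s1P|apply: s2P] => //; lra.
transitivity (\sum_(e <- s3) \sum_(a <- s1) f a * g (e - a) * h (c - e)); last first.
  apply: eq_bigr => e _; rewrite -mulr_suml.
  case: (eqVneq (h (c - e)) 0) => [->|he]; first by rewrite !mulr0.
  congr (_ * _); apply/esym/mulSE => // a fa gea; apply: s1P => //.
  by have := mgP _ gea; have := mhP _ he; lra.
rewrite exchange_big /=; apply: eq_big_seq => a as1.
under eq_bigr => e _ do rewrite -mulrA.
rewrite -mulr_sumr; case: (eqVneq (f a) 0) => [->|fa]; first by rewrite !mul0r.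
congr (_ * _); rewrite (@mulSE _ _ _ [seq e - a | e <- s3]).
- by rewrite big_map; apply: eq_bigr => e _; congr (_ * h _); ring.
- by rewrite map_inj_uniq ?undup_uniq // => x y /addIr.
- move=> b gb hb; apply/mapP; exists (a + b); last by ring.
  apply: s3P => //; apply: s2P => //.
  by have := mfP _ fa; have := mhP _ hb; lra.
Qed.

Lemma mulSDl f g h : gpuiseux f -> gpuiseux g -> gpuiseux h ->
  mulS (addS f g) h = addS (mulS f h) (mulS g h).
Proof.
move=> gf gg gh; apply: funext => c; rewrite {2}/addS.
have [s1 [_ s1P]] := mulS_seq c gf gh; have [s2 [_ s2P]] := mulS_seq c gg gh.
have us : uniq (undup (s1 ++ s2)) by apply: undup_uniq.
rewrite !(@mulSE _ h c (undup (s1 ++ s2))) //.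
- by rewrite -big_split; apply: eq_bigr => a _; rewrite /addS mulrDl.
- by move=> a ga ha; rewrite mem_undup mem_cat s2P ?orbT.
- by move=> a fa ha; rewrite mem_undup mem_cat s1P.
- move=> a; rewrite /addS mem_undup mem_cat => fga ha.
  case: (eqVneq (f a) 0) fga => [->|fa] fga; last by rewrite s1P.
  by rewrite s2P ?orbT //; move: fga; rewrite add0r.
Qed.

Lemma mul1S g : mulS (@oneS R) g = g.
Proof.
apply: funext => c; rewrite (@mulSE _ _ _ [:: 0]) // ?big_seq1 /oneS ?eqxx ?mul1r ?subr0 //.
by move=> a; case: ifP => [/eqP ->|_]; rewrite ?inE eqxx.
Qed.

Lemma mulS_lead f g a b : (forall x, x < a -> f x = 0) -> (forall x, x < b -> g x = 0) ->
  (forall c, c < a + b -> mulS f g c = 0) /\ mulS f g (a + b) = f a * g b.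
Proof.
move=> fa gb; split=> [c cab|].
  apply/eqP; apply: contraTT cab => /mulS_supp[x [fx gx]]; rewrite -leNgt.
  have : a <= x by rewrite leNgt; apply: contraNN fx => /fa->.
  have : b <= c - x by rewrite leNgt; apply: contraNN gx => /gb->.
  by lra.
rewrite (@mulSE _ _ _ [:: a]) // ?big_seq1; first by congr (_ * g _); ring.
move=> x fx gx; rewrite inE.
have : a <= x by rewrite leNgt; apply: contraNN fx => /fa->.
have : b <= a + b - x by rewrite leNgt; apply: contraNN gx => /gb->.
by move=> *; apply/eqP; lra.
Qed.

Record gps := Gps {gps_val : series R; gps_prop : gpuiseux gps_val}.

Lemma gps_inj (x y : gps) : gps_val x = gps_val y -> x = y.
Proof.
by case: x y => [x px] [y py] /= e; move: py; rewrite -e => py; rewrite (Prop_irrelevance px py).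
Qed.

HB.instance Definition _ := gen_eqMixin gps.
HB.instance Definition _ := gen_choiceMixin gps.

Definition gps_zero := Gps gpuiseux_zero.
Definition gps_add (x y : gps) := Gps (gpuiseux_add (gps_prop x) (gps_prop y)).
Definition gps_opp (x : gps) := Gps (gpuiseux_scale (-1) (gps_prop x)).

Lemma gps_addA : associative gps_add.
Proof. by move=> x y z; apply: gps_inj; apply: funext => a; rewrite /= /addS addrA. Qed.
Lemma gps_addC : commutative gps_add.
Proof. by move=> x y; apply: gps_inj; apply: funext => a; rewrite /= /addS addrC. Qed.
Lemma gps_add0 : left_id gps_zero gps_add.
Proof. by move=> x; apply: gps_inj; apply: funext => a; rewrite /= /addS add0r. Qed.
Lemma gps_addN : left_inverse gps_zero gps_opp gps_add.
Proof.
by move=> x; apply: gps_inj; apply: funext => a; rewrite /= /addS /scaleS mulN1r addNr.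
Qed.

HB.instance Definition _ := GRing.isZmodule.Build gps gps_addA gps_addC gps_add0 gps_addN.

Definition gps_one := Gps gpuiseux_one.
Definition gps_mul (x y : gps) := Gps (gpuiseux_mul (gps_prop x) (gps_prop y)).

Lemma gps_mulA : associative gps_mul.
Proof. by move=> [x px] [y py] [z pz]; apply: gps_inj; apply: mulSA. Qed.
Lemma gps_mulC : commutative gps_mul.
Proof. by move=> [x px] [y py]; apply: gps_inj; apply: mulSC. Qed.
Lemma gps_mul1 : left_id gps_one gps_mul.
Proof. by move=> [x px]; apply: gps_inj; apply: mul1S. Qed.
Lemma gps_mulDl : left_distributive gps_mul gps_add.
Proof. by move=> [x px] [y py] [z pz]; apply: gps_inj; apply: mulSDl. Qed.
Lemma gps_one_neq0 : gps_one != 0.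
Proof.
apply/eqP => /(congr1 (fun x => gps_val x 0)) /=; rewrite /oneS /zeroS eqxx => /eqP.
by rewrite oner_eq0.
Qed.

HB.instance Definition _ := GRing.Zmodule_isComNzRing.Build gps
  gps_mulA gps_mulC gps_mul1 gps_mulDl gps_one_neq0.

(** The unit ring interface asks for a partial inverse; it is obtained by classical choice, without
    constructing geometric series. *)
Definition gps_unit : {pred gps} := fun x => `[< exists y : gps, y * x = 1 >].
Definition gps_inv (x : gps) : gps :=
  if pselect (exists y : gps, y * x = 1) is left ex then projT1 (cid ex) else x.

Lemma gps_mulVx : {in gps_unit, left_inverse 1 gps_inv *%R}.
Proof.
move=> x /asboolP ex; rewrite /gps_inv; case: pselect => // ex'.
by case: cid.
Qed.
Lemma gps_unitPl (x y : gps) : y * x = 1 -> gps_unit x.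
Proof. by move=> xy; apply/asboolP; exists y. Qed.
Lemma gps_inv_out : {in [predC gps_unit], gps_inv =1 id}.
Proof.
by move=> x /asboolPn nx; rewrite /gps_inv; case: pselect.
Qed.

HB.instance Definition _ := GRing.ComNzRing_hasMulInverse.Build gps
  gps_mulVx gps_unitPl gps_inv_out.

Lemma gps_lead (x : gps) : x != 0 ->
  exists a, gps_val x a != 0 /\ forall b, b < a -> gps_val x b = 0.
Proof.
move=> /eqP x0; apply: gpuiseux_lead (gps_prop x) _ => e; apply: x0.
exact: gps_inj.
Qed.

Lemma gps_integral : GRing.integral_domain_axiom gps.
Proof.
move=> x y xy0; rewrite -[_ || _]negbK negb_or; apply/negP => /andP[].
move=> /gps_lead[a [xa la]] /gps_lead[b [yb lb]].
have [_] := mulS_lead la lb.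
have -> : mulS (gps_val x) (gps_val y) = @zeroS R by exact: (congr1 gps_val xy0).
by move/esym/eqP; rewrite mulf_eq0 (negbTE xa) (negbTE yb).
Qed.

HB.instance Definition _ := GRing.ComUnitRing_isIntegral.Build gps gps_integral.

Definition gps_le (x y : gps) : bool := `[< nonnegS (gps_val (y - x)) >].
Definition gps_norm (x : gps) : gps := if gps_le 0 x then x else - x.

Lemma gps_le0P (x : gps) : reflect
  (x = 0 \/ exists a, 0 < gps_val x a /\ forall b, b < a -> gps_val x b = 0) (gps_le 0 x).
Proof.
apply: (iffP (asboolP _)); rewrite subr0.
  by case=> [x0|]; [left; apply: gps_inj|right].
by case=> [->|]; [left|right].
Qed.

Lemma gps_le0_add (x y : gps) : gps_le 0 x -> gps_le 0 y -> gps_le 0 (x + y).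
Proof.
move=> hx hy; apply/gps_le0P; move/gps_le0P: hx => [->|[a [xa la]]].
  by rewrite add0r; apply/gps_le0P.
move/gps_le0P: hy => [->|[b [yb lb]]]; first by rewrite addr0; right; exists a.
right; rewrite /= /addS; case: (ltgtP a b) => ab; [exists a|exists b|exists a].
- by rewrite (lb _ ab) addr0; split=> // c ca; rewrite la // lb ?addr0 //; apply: lt_trans ab.
- by rewrite (la _ ab) add0r; split=> // c ca; rewrite lb // la ?addr0 //; apply: lt_trans ab.
- by split=> [|c ca]; [rewrite addr_gt0 // ab|rewrite la // lb ?addr0 // -ab].
Qed.

Lemma gps_le0_mul (x y : gps) : gps_le 0 x -> gps_le 0 y -> gps_le 0 (x * y).
Proof.
move=> /gps_le0P[->|[a [xa la]]]; first by rewrite mul0r => _; apply/gps_le0P; left.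
move=> /gps_le0P[->|[b [yb lb]]]; first by rewrite mulr0; apply/gps_le0P; left.
apply/gps_le0P; right; exists (a + b); have [l e] := mulS_lead la lb.
by rewrite /= e; split=> //; apply: mulr_gt0.
Qed.

Lemma gps_sub_ge0 (x y : gps) : gps_le 0 (y - x) = gps_le x y.
Proof. by rewrite /gps_le subr0. Qed.

Lemma gps_le0_anti (x : gps) : gps_le 0 x -> gps_le x 0 -> x = 0.
Proof.
rewrite -[gps_le x 0]gps_sub_ge0 sub0r.
move=> /gps_le0P[//|[a [xa la]]] /gps_le0P[/eqP|[b [yb lb]]].
  by rewrite oppr_eq0 => /eqP.
move: yb; rewrite /= /scaleS mulN1r oppr_gt0 => yb.
have nb c : c < b -> gps_val x c = 0.
  by move=> /lb; rewrite /= /scaleS mulN1r => /eqP; rewrite oppr_eq0 => /eqP.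
case: (ltgtP a b) => [/nb e|/la e|e]; first by rewrite e ltxx in xa.
  by rewrite e ltxx in yb.
by rewrite -e in yb; have := lt_trans xa yb; rewrite ltxx.
Qed.

Lemma gps_le0_total (x : gps) : gps_le 0 x || gps_le x 0.
Proof.
rewrite -[gps_le x 0]gps_sub_ge0 sub0r.
case: (eqVneq x 0) => [->|/gps_lead[a [xa la]]].
  by apply/orP; left; apply/gps_le0P; left.
case: (ltgtP (gps_val x a) 0) => [neg|pos|e]; last by rewrite e eqxx in xa.
  apply/orP; right; apply/gps_le0P; right; exists a; rewrite /= /scaleS mulN1r oppr_gt0.
  by split=> // b /la->; rewrite mulr0.
by apply/orP; left; apply/gps_le0P; right; exists a.
Qed.

Lemma gps_normN (x : gps) : gps_norm (- x) = gps_norm x.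
Proof.
rewrite /gps_norm; have e : gps_le 0 (- x) = gps_le x 0 by rewrite -sub0r gps_sub_ge0.
rewrite e; have := gps_le0_total x; case: ifP; case: ifP => //= h1 h2 _.
  by rewrite (gps_le0_anti h1 h2) oppr0.
by rewrite opprK.
Qed.

Lemma gps_ge0_norm (x : gps) : gps_le 0 x -> gps_norm x = x.
Proof. by rewrite /gps_norm => ->. Qed.

HB.instance Definition _ := Num.IntegralDomain_isLeReal.Build gps
  gps_le0_add gps_le0_mul gps_le0_anti gps_sub_ge0 gps_le0_total
  gps_normN gps_ge0_norm (fun _ _ => erefl).

End SeriesRing.

(** * Totally non-negative valuated flag matroids *)

Section Valuation.
Variable R : realType.
Local Notation gps := (gps R).
Implicit Types (x y : gps).

Definition gps_valuation x : \bar R := valS (gps_val x).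
Local Notation v := gps_valuation.

Lemma valS_le (f : series R) a : f a != 0 -> (valS f <= a%:E)%E.
Proof. by move=> fa; apply: ereal_inf_lbound; exists a. Qed.

Lemma valS_lead (f : series R) a : f a != 0 -> (forall b, b < a -> f b = 0) ->
  valS f = a%:E.
Proof.
move=> fa la; apply/eqP; rewrite eq_le valS_le //=; apply/ereal_infP => _ [b fb <-]; rewrite lee_fin leNgt; apply: contraNN fb => ba.
by rewrite la.
Qed.

Lemma gps_valuation0 : v 0 = +oo%E.
Proof.
rewrite /v /valS; suff -> : supp (gps_val (0 : gps)) = set0.
  by rewrite image_set0 ereal_inf0.
by apply/seteqP; split=> // a; rewrite /supp /= /zeroS eqxx.
Qed.

Lemma gps_valuationM x y : v (x * y) = (v x + v y)%E.
Proof.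
case: (eqVneq x 0) => [->|x0].
  rewrite mul0r gps_valuation0; case: (eqVneq y 0) => [->|/gps_lead[b [yb lb]]].
    by rewrite gps_valuation0.
  by rewrite /v (valS_lead yb lb).
case: (eqVneq y 0) => [->|/gps_lead[b [yb lb]]].
  rewrite mulr0 gps_valuation0; have [a [xa la]] := gps_lead x0.
  by rewrite /v (valS_lead xa la).
have [a [xa la]] := gps_lead x0; rewrite /v (valS_lead xa la) (valS_lead yb lb).
have [l e] := mulS_lead la lb; rewrite -EFinD; apply: valS_lead => //.
by rewrite /= e mulf_neq0.
Qed.

Lemma gps_ge0P x : reflect
  (x = 0 \/ exists a, 0 < gps_val x a /\ forall b, b < a -> gps_val x b = 0) (0 <= x).
Proof. exact: gps_le0P. Qed.

(** If [y] had no coefficient up to the leading exponent of [x], then [y - x] would start with the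
    negative of the leading term of [x]. Here positivity enters the comparison of valuations. *)
Lemma gps_valuation_anti x y : 0 <= x -> x <= y -> (v y <= v x)%E.
Proof.
move=> /gps_ge0P[->|[a [xa la]]]; first by rewrite gps_valuation0 leey.
rewrite -subr_ge0 => h; rewrite [X in (_ <= X)%E](valS_lead _ la) ?gt_eqF //.
have [[b [ba yb]]|nb] := pselect (exists b, b <= a /\ gps_val y b != 0).
  by apply: le_trans (valS_le yb) _; rewrite lee_fin.
have {}nb b : b <= a -> gps_val y b = 0.
  by move=> ba; apply/eqP; apply: contrapT => /negP yb; apply: nb; exists b.
have e b : b <= a -> gps_val (y - x) b = - gps_val x b.
  by move=> ba; rewrite /= /addS /scaleS nb // add0r mulN1r.
move/gps_ge0P: h => [h|[b [pb lb]]].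
  have := e a (lexx _); rewrite h /= => /eqP.
  by rewrite eq_sym oppr_eq0 gt_eqF.
case: (leP b a) => ba; last first.
  have := lb _ ba; rewrite e // => /eqP; by rewrite oppr_eq0 gt_eqF.
move: pb; rewrite e // oppr_gt0; case: (ltgtP b a) ba => // [/la ->|->] _.
  by rewrite ltxx.
by rewrite ltNge ltW.
Qed.

Lemma gps_valuationD x y : (Order.min (v x) (v y) <= v (x + y)%R)%E.
Proof.
case: (eqVneq (x + y) 0) => [->|/gps_lead[a [xya la]]].
  by rewrite gps_valuation0 leey.
rewrite [X in (_ <= X)%E](valS_lead xya la) ge_min.
case: (eqVneq (gps_val x a) 0) xya => xa; last by rewrite valS_le.
rewrite /= /addS xa add0r => ya.
by rewrite [X in _ || X]valS_le ?orbT.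
Qed.

Variable n : nat.

Lemma gps_val_det d (M : 'M[gps]_d) :
  gps_val (\det M) = detS (fun i j => gps_val (M i j)).
Proof.
rewrite /determinant /detS (@big_morph _ _ (@gps_val R) (@zeroS R) (@addS R)) //.
apply: eq_bigr => sg _.
have -> (z : gps) : gps_val ((-1) ^+ sg * z) = scaleS ((-1) ^+ sg) (gps_val z).
  apply: funext => a; case: (odd_perm sg); rewrite /scaleS.
    by rewrite !expr1 mulN1r.
  by rewrite !expr0 !mul1r.
by congr (scaleS _ _); rewrite (@big_morph _ _ (@gps_val R) (@oneS R) (@mulS R)).
Qed.

Lemma gps_val_minor (A : nat -> 'I_n -> gps) (B : {set 'I_n}) :
  gps_val (minor A B) = plS (fun i k => gps_val (A i k)) B.
Proof.
rewrite /minor gps_val_det /plS; congr detS; apply: funext => i; apply: funext => k.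
by rewrite !mxE.
Qed.
End Valuation.

(** * The inequality between neighbouring lambda-values *)

Section Part1.
Variables (R : realType) (n s : nat) (d : 'I_s -> nat).
Variable mu : 'I_s -> {set 'I_n} -> \bar R.
Implicit Types (S T : {set 'I_n}) (i : 'I_s).

(** Indexed by the element of [T :\: S] instead of its position; [lamxE] and [lamxP] translate. *)
Definition lambda (i i' : 'I_s) S T (t : 'I_n) : \bar R :=
  (mu i (t |: S) + mu i' (T :\ t))%E.

Lemma lamxE i i' S T t : t \in T :\: S ->
  lamx mu i i' S T (index t (enum (T :\: S))).+1 = lambda i i' S T t.
Proof.
move=> tU; rewrite /lamx /= (nth_map t) ?nth_index ?mem_enum //.
by rewrite index_mem mem_enum.
Qed.

Lemma lamxP S T k : (1 <= k <= #|T :\: S|)%N ->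
  exists2 t, t \in T :\: S & k = (index t (enum (T :\: S))).+1.
Proof.
case: k => // k /= kU; case: (pickP (mem (T :\: S))) => [x0 _|U0]; last first.
  by move: kU; rewrite (eq_card0 U0).
rewrite cardE in kU; exists (nth x0 (enum (T :\: S)) k).
  by rewrite -mem_enum mem_nth.
by rewrite index_uniq ?enum_uniq.
Qed.

Lemma index_adjacent (U : {set 'I_n}) a b : adjacent U a b ->
  index b (enum U) = (index a (enum U)).+1.
Proof.
move=> [aU bU ab no]; rewrite !index_below // /below (cardsD1 a) inE aU ab.
congr _.+1; apply: eq_card => k; rewrite !inE.
have := no k; case: (boolP (k \in U)) => kU; last by rewrite andbF.
by rewrite -val_eqE => /(_ isT) /=; lia.
Qed.

Lemma plucker_pair_card i i' S T :
  (forall j k : 'I_s, (j < k)%N -> (d j < d k)%N) -> plucker_pair d i i' S T ->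
  [/\ S \subset T, (#|S|.+1 < #|T|)%N, (0 < d i)%N, #|S|.+1 = d i & #|T| = (d i').+1].
Proof.
move=> dP [di ST cS cT ii']; rewrite cS cT prednK //; split=> //.
rewrite ltnS; case: ii' => [->//|e]; apply: ltnW; apply: dP; lia.
Qed.

Lemma totally_nonneg_lambda i i' S T k :
  (forall j k : 'I_s, (j < k)%N -> (d j < d k)%N) ->
  totally_nonneg d mu -> plucker_pair d i i' S T -> (1 <= k <= #|T :\: S|)%N ->
  (Order.min (lamx mu i i' S T k.-1) (lamx mu i i' S T k.+1) <= lamx mu i i' S T k)%E.
Proof.
move=> dP [A0 [sc0 [gA pl0 scP [c muE]]]] pp; have [ST cST di cS cT] := plucker_pair_card dP pp.
move=> /lamxP[t tU ->]; rewrite lamxE //=.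
pose A := fun (a : nat) j => Gps (gA a j).
pose sc m : gps R := if pselect (gpuiseux (sc0 m)) is left h then Gps h else 0.
have scE m : (m <= n)%N -> gps_val (sc m) = sc0 m.
  by move=> /scP[h _ _]; rewrite /sc; case: pselect.
have cardn (B : {set 'I_n}) : (#|B| <= n)%N by rewrite -[leqRHS]card_ord max_card.
(* The scalar depends on the rank only, so every term of the relation of [S'] and [T'] acquires the
   same factor and [p] is still a Pluecker vector. *)
pose p (B : {set 'I_n}) := sc #|B| * minor A B.
have pE (B : {set 'I_n}) : gps_val (p B) = mulS (sc0 #|B|) (plS A0 B).
  by rewrite /p /= scE // gps_val_minor.
have p_ge0 B : 0 <= p B.
  have [_ _ h] := scP _ (cardn B); have := h B erefl; rewrite -pE => hp.
  by apply/gps_le0P; case: hp => [e|?]; [left; apply: gps_inj|right].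
have pP : plucker_vector p.
  move=> S' T' c'; apply: etrans (mulr0 (sc #|S'|.+1 * sc #|T'|.-1)).
  apply: etrans (congr1 _ (plucker_relation A c')).
  rewrite mulr_sumr; apply: eq_bigr => x; rewrite inE => /andP[xS xT].
  rewrite /p cardsU1 xS add1n.
  have -> : #|T' :\ x| = #|T'|.-1 by rewrite (cardsD1 x T') xT.
  by ring.
have sc_neq0 m : (m <= n)%N -> sc m != 0.
  move=> mn; have [_ h _] := scP _ mn; apply: contra_neq h => e.
  by rewrite -scE // e.
have p_rank m : (m <= n)%N -> exists2 B : {set 'I_n}, #|B| = m & p B != 0.
  move=> mn; suff [B cB mB] : exists2 B : {set 'I_n}, #|B| = m & minor A B != 0.
    by exists B => //; rewrite /p mulf_neq0 // sc_neq0 // cB.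
  (* Start from the non-zero minor on all columns and delete one column at a time. *)
  rewrite -(subKn mn); elim: (n - m)%N => [|j [B cB mB]].
    exists [set: 'I_n]%SET; first by rewrite cardsT card_ord subn0.
    by apply: contra_neq pl0 => e; rewrite -[plS _ _](gps_val_minor A) e.
  case: (posnP #|B|) => B0; first by exists B => //; move: cB; rewrite B0; lia.
  have [x xB mx] := minor_descend B0 mB; exists (B :\ x) => //.
  by have := cardsD1 x B; rewrite xB cB /=; lia.
have lE x : x \in T :\: S -> lambda i i' S T x =
    (gps_valuation (p (x |: S) * p (T :\ x))%R + (c i + c i')%:E)%E.
  rewrite inE => /andP[xS xT].
  have c1 : #|x |: S| = d i by rewrite cardsU1 xS add1n cS.
  have c2 : #|T :\ x| = d i' by have := cardsD1 x T; rewrite xT cT => -[].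
  rewrite /lambda !muE // gps_valuationM /gps_valuation !pE c1 c2 EFinD.
  by rewrite addeACA.
have [x [y [x0 y0 F hx hy]]] := plucker_adjacent_split pP p_rank p_ge0 ST cST tU.
rewrite lE // F; apply: (@le_trans _ _
    (Order.min (gps_valuation x) (gps_valuation y) + (c i + c i')%:E)%E); last first.
  by rewrite leeD2r // gps_valuationD.
(* A zero summand has infinite valuation, which settles the ends, where there is no neighbour. *)
have low z j : (z = 0 \/ exists2 a, j = (index a (enum (T :\: S))).+1 /\ a \in T :\: S
      & z <= p (a |: S) * p (T :\ a)) -> 0 <= z ->
    (lamx mu i i' S T j <= gps_valuation z + (c i + c i')%:E)%E.
  case=> [->|[a [-> aU] za]] z0; first by rewrite gps_valuation0 addye ?leey.
  by rewrite lamxE // lE // leeD2r // gps_valuation_anti.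
have lx : (lamx mu i i' S T (index t (enum (T :\: S))) <=
    gps_valuation x + (c i + c i')%:E)%E.
  apply: low => //; case: hx => [->|[a at_ ha]]; [by left|right; exists a => //].
  by split; [rewrite (index_adjacent at_)|case: at_].
have ly : (lamx mu i i' S T (index t (enum (T :\: S))).+2 <=
    gps_valuation y + (c i + c i')%:E)%E.
  apply: low => //; case: hy => [->|[a ta ha]]; [by left|right; exists a => //].
  by split; [rewrite (index_adjacent ta)|case: ta].
by case: (leP (gps_valuation x) (gps_valuation y)) => _; rewrite ge_min ?lx ?ly ?orbT.
Qed.
End Part1.

(** * Valuated matroids and weight vectors *)

Section ValuatedMatroid.
Variables (R : realType) (n : nat).
Implicit Types (B S T : {set 'I_n}) (P : pred {set 'I_n}) (h : {set 'I_n} -> R).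
Implicit Types (m : {set 'I_n} -> \bar R) (x : 'rV[R]_n) (t u v : 'I_n) (d : nat).

Definition swap B u v : {set 'I_n} := v |: B :\ u.

(** The exchange property of valuated matroids. Confining it to [P] keeps infinite values out of the
    real function [h]. *)
Definition valuated_exchange P h := forall B B' u, P B -> P B' -> u \in B :\: B' ->
  exists v, [/\ v \in B' :\: B, P (swap B u v), P (swap B' v u) &
    h (swap B u v) + h (swap B' v u) <= h B + h B'].

Lemma card_swap B u v : u \in B -> v \notin B -> #|swap B u v| = #|B|.
Proof.
move=> uB vB; rewrite /swap cardsU1 !inE negb_and vB orbT /=.
by rewrite (cardsD1 u B) uB.
Qed.

Lemma dotB_swap x B u v : u \in B -> v \notin B ->
  dotB x (swap B u v) = dotB x B - x 0 u + x 0 v.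
Proof.
move=> uB vB; rewrite /dotB /swap big_setU1 ?inE ?negb_and ?vB ?orbT //=.
by rewrite (big_setD1 u uB) /=; ring.
Qed.

(** The element [u] leaves one basis for the other and [v] goes back, so the total linear
    contribution does not change. *)
Lemma valuated_exchange_shift P h x : valuated_exchange P h ->
  valuated_exchange P (fun B => h B - dotB x B).
Proof.
move=> ex B B' u PB PB' uB; have [v [vB P1 P2 le]] := ex B B' u PB PB' uB.
exists v; split=> //; move: uB vB; rewrite !inE => /andP[uB' uB] /andP[vB vB'].
by rewrite !dotB_swap //; lra.
Qed.

Lemma setD_neq0 B B' : #|B| = #|B'| -> B != B' -> exists u, u \in B :\: B'.
Proof.
move=> c BB'; apply/set0Pn; rewrite finset.setD_eq0; apply: contra BB' => s.
by rewrite eqEcard s c leqnn.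
Qed.

Section Exchange.
Variables (P : pred {set 'I_n}) (h : {set 'I_n} -> R) (d : nat).
Hypothesis Pd : forall B, P B -> #|B| = d.
Hypothesis ex : valuated_exchange P h.

(** Induction on the distance to [B']. In the exchange inequality the swap of [B] does not gain, so
    the swap of [B'] does not lose, and that one is closer to [B]. *)
Lemma local_optimum B : P B ->
  (forall u v, u \in B -> v \notin B -> P (swap B u v) -> h B <= h (swap B u v)) ->
  forall B', P B' -> h B <= h B'.
Proof.
move=> PB loc B'; have [k] := ubnP #|B :\: B'|; elim: k B' => // k IH B' Bk PB'.
case: (eqVneq B B') => [->//|BB'].
have [u uB] : exists u, u \in B :\: B' by apply: setD_neq0 => //; rewrite !Pd.
have [v [vB P1 P2 le]] := ex PB PB' uB.
have uv := uB; have vv := vB; rewrite !inE in uv vv.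
case/andP: uv => uB' uB1; case/andP: vv => vB1 vB'.
have h1 := loc u v uB1 vB1 P1.
suff : h B <= h (swap B' v u) by lra.
apply: IH => //; rewrite ltnS in Bk; apply: leq_trans Bk; apply: proper_card.
apply/properP; split; last by exists u => //; rewrite !inE eqxx.
apply/fintype.subsetP => k'; rewrite !inE negb_or negb_and negbK => /andP[/andP[ku kv] kB].
rewrite kB andbT; case/orP: kv => [/eqP e|//]; by rewrite e (negbTE vB1) in kB.
Qed.

Lemma optimum_exchange B B' : P B -> P B' -> h B = h B' -> B != B' ->
  (forall B1, P B1 -> h B <= h B1) ->
  exists u v, [/\ u \in B :\: B', v \in B' :\: B, P (swap B u v), h (swap B u v) = h B &
   P (swap B' v u) /\ h (swap B' v u) = h B].
Proof.
move=> PB PB' e BB' opt.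
have [u uB] : exists u, u \in B :\: B' by apply: setD_neq0 => //; rewrite !Pd.
have [v [vB P1 P2 le]] := ex PB PB' uB; exists u, v.
have := opt _ P1; have := opt _ P2 => h1 h2.
by split=> //; [|split=> //]; lra.
Qed.
End Exchange.

Definition basis d m : pred {set 'I_n} := fun B => (#|B| == d) && (m B != +oo%E).

Lemma basis_fin d m B : valuated_matroid d m -> basis d m B ->
  m B = (fine (m B))%:E.
Proof.
move=> [ninf _ _] /andP[/eqP cB mB]; rewrite fineK // fin_numE mB andbT.
exact: ninf.
Qed.

Lemma valuated_matroid_exchange d m : valuated_matroid d m ->
  valuated_exchange (basis d m) (fun B => fine (m B)).
Proof.
move=> vm B B' u bB bB' uBB'.
have [ninf _ tp] := vm.
move: (uBB'); rewrite !inE => /andP[uB' uB].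
have /andP[/eqP cB mB] := bB; have /andP[/eqP cB' mB'] := bB'.
have d0 : (0 < d)%N by rewrite -cB; apply/card_gt0P; exists u.
pose S := B :\ u; pose T := u |: B'; pose f t := (m (t |: S) + m (T :\ t))%E.
have cS : #|S| = d.-1 by rewrite -cB (cardsD1 u B) uB.
have cT : #|T| = d.+1 by rewrite cardsU1 uB' cB'.
have uT : u \in T :\: S by rewrite !inE eqxx.
have fu : f u = (m B + m B')%E by rewrite /f finset.setD1K // finset.setU1K.
have [v [vT vu le]] : exists v, [/\ v \in T :\: S, v != u & (f v <= f u)%E].
  (* The sum for [B] and [B'] is the term of [u]. Any other minimiser will do; if [u] itself is one,
     the minimum is attained a second time. *)
  case: (@arg_minP _ _ _ u (fun t => t \in T :\: S) f uT) => t tT tmin.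
  case: (eqVneq t u) => [tu|tu]; last by exists t; split=> //; apply: tmin.
  rewrite {}tu in tmin tT.
  have [||t' [t'T t'u e]] := tp d0 S T cS cT u uT.
  - by move=> t' /tmin.
  - by rewrite -/(f u) fu (basis_fin vm bB) (basis_fin vm bB').
  by exists t'; split=> //; rewrite /f e.
have {vT} [vB vB'] : v \notin B /\ v \in B'.
  by move: vT; rewrite !inE (negbTE vu) /= => /andP[].
have e1 : v |: S = swap B u v by [].
have e2 : T :\ v = swap B' v u.
  apply/setP => k; rewrite !inE; case: (eqVneq k v) => [->|_] //=.
  by rewrite (negbTE vu).
exists v; rewrite !inE vB vB'.
have c1 : #|swap B u v| = d by rewrite card_swap.
have c2 : #|swap B' v u| = d by rewrite card_swap.
move: le; rewrite fu /f e1 e2 (basis_fin vm bB) (basis_fin vm bB') /basis c1 c2 eqxx /=.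
have := ninf _ c1; have := ninf _ c2.
by case: (m (swap B u v)) => [a||] //; case: (m (swap B' v u)) => [b||].
Qed.

(** Literally the condition inside [cell], so that [cellE] holds by conversion. *)
Definition minimizer d m x B := #|B| = d /\ forall B', #|B'| = d ->
  (m B - (dotB x B)%:E <= m B' - (dotB x B')%:E)%E.

Lemma minimizerP d m x B : valuated_matroid d m ->
  minimizer d m x B <-> basis d m B /\ forall B', basis d m B' ->
    fine (m B) - dotB x B <= fine (m B') - dotB x B'.
Proof.
move=> vm; have [ninf [B0 [cB0 mB0]] _] := vm.
have bB0 : basis d m B0 by rewrite /basis cB0 eqxx.
split=> [[cB opt]|[bB opt]].
  have bB : basis d m B.
    rewrite /basis cB eqxx /=; apply/eqP => e; have := opt _ cB0.
    by rewrite e (basis_fin vm bB0) /= leNgt ltry.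
  split=> // B' bB'; have /andP[/eqP cB' _] := bB'; have := opt _ cB'.
  by rewrite (basis_fin vm bB) (basis_fin vm bB').
have /andP[/eqP cB _] := bB; split=> // B' cB'.
case: (eqVneq (m B') +oo%E) => [->|mB']; first by rewrite (basis_fin vm bB) /= leey.
have bB' : basis d m B' by rewrite /basis cB' eqxx.
by rewrite (basis_fin vm bB) (basis_fin vm bB') lee_fin; apply: opt.
Qed.

Variables (d1 d2 : nat) (m1 m2 : {set 'I_n} -> \bar R).
Hypotheses (vm1 : valuated_matroid d1 m1) (vm2 : valuated_matroid d2 m2).

(* [x] vanishes at [t0], separates the two exchange costs on the rest of [T :\: S],
   and is so large on [S] and so small off [T] that optimal bases respect [S] and [T]. *)
Lemma weight_vector S T t0 : S \subset T -> #|S|.+1 = d1 -> #|T| = d2.+1 ->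
  t0 \in T :\: S -> (m1 (t0 |: S) + m2 (T :\ t0) != +oo)%E ->
  (forall t, t \in T :\: S ->
     (m1 (t0 |: S) + m2 (T :\ t0) <= m1 (t |: S) + m2 (T :\ t))%E) ->
  exists x, [/\ minimizer d1 m1 x (t0 |: S), minimizer d2 m2 x (T :\ t0),
    forall B, minimizer d1 m1 x B -> exists2 t, t \in T :\: S & B = t |: S /\
      (m1 (t |: S) + m2 (T :\ t) = m1 (t0 |: S) + m2 (T :\ t0))%E &
    forall B, minimizer d2 m2 x B -> exists2 t, t \in T :\: S & B = T :\ t /\
      (m1 (t |: S) + m2 (T :\ t) = m1 (t0 |: S) + m2 (T :\ t0))%E].
Proof.
move=> ST cS cT t0U fin0 opt0.
have U_S t : t \in T :\: S -> t \notin S by rewrite inE => /andP[].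
have U_T t : t \in T :\: S -> t \in T by rewrite inE => /andP[].
have c1 t : t \in T :\: S -> #|t |: S| = d1.
  by move=> /U_S tS; rewrite cardsU1 tS add1n.
have c2 t : t \in T :\: S -> #|T :\ t| = d2.
  by move=> /U_T tT; have := cardsD1 t T; rewrite tT cT => -[].
have [ninf1 _ _] := vm1; have [ninf2 _ _] := vm2.
pose g1 B := fine (m1 B); pose g2 B := fine (m2 B).
pose b1 t := basis d1 m1 (t |: S); pose b2 t := basis d2 m2 (T :\ t).
have [b10 b20] : b1 t0 /\ b2 t0.
  rewrite /b1 /b2 /basis c1 // c2 // !eqxx /=; move: fin0.
  have := ninf1 _ (c1 _ t0U); have := ninf2 _ (c2 _ t0U).
  by case: (m1 _) => [a||] //; case: (m2 _).
(* With weight 0 at [t0], the basis [t |: S] does not beat [t0 |: S] iff [x t <= hi t], and [T :\ t]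
   does not beat [T :\ t0] iff [lo t <= x t]. *)
pose lo t := g2 (T :\ t0) - g2 (T :\ t); pose hi t := g1 (t |: S) - g1 (t0 |: S).
have lohi t : t \in T :\: S -> b1 t -> b2 t -> lo t <= hi t /\
    (lo t = hi t -> (m1 (t |: S) + m2 (T :\ t) = m1 (t0 |: S) + m2 (T :\ t0))%E).
  move=> tU b1t b2t; have := opt0 _ tU.
  rewrite (basis_fin vm1 b1t) (basis_fin vm2 b2t) (basis_fin vm1 b10) (basis_fin vm2 b20).
  rewrite -!EFinD lee_fin /lo /hi /g1 /g2 => h; split; first by lra.
  by move=> e; congr EFin; lra.
(* The midpoint makes both comparisons strict unless [lo t = hi t], that is, unless the two
   lambda-values agree. If only one of the two sets is a basis, a shift by 1 makes its comparison
   strict. *)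
pose y t := if b1 t then (if b2 t then (lo t + hi t) / 2 else hi t - 1)
            else (if b2 t then lo t + 1 else 0).
pose K := \sum_(B : {set 'I_n}) (`|g1 B| + `|g2 B|).
pose Y := \sum_t `|y t|.
have KB B : `|g1 B| + `|g2 B| <= K.
  by rewrite /K (bigD1 B) //= lerDl sumr_ge0 // => *; apply: addr_ge0.
have Yt t : `|y t| <= Y.
  by rewrite /Y (bigD1 t) //= lerDl sumr_ge0.
(* Differences of values are at most [2 * K] and the other weights at most [Y], so a swap that
   removes an element of [S] or inserts one off [T] is strictly worse. *)
pose L := 2 * K + Y + 1.
pose x := \row_t (if t \in S then L else if t \in T then (if t == t0 then 0 else y t) else - L).
have xS t : t \in S -> x 0 t = L by move=> tS; rewrite mxE tS.
have xT t : t \notin T -> x 0 t = - L.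
  move=> tT; rewrite mxE (negbTE tT) ifN //; apply: contra tT.
  exact: (fintype.subsetP ST).
have x0 : x 0 t0 = 0 by rewrite mxE (negbTE (U_S _ t0U)) (U_T _ t0U) eqxx.
have xU t : t \in T :\: S -> t != t0 -> x 0 t = y t.
  by move=> tU /negbTE e; rewrite mxE (negbTE (U_S _ tU)) (U_T _ tU) e.
have bound1 B B' : - (2 * K) <= g1 B' - g1 B.
  have := KB B; have := KB B'; have := normr_ge0 (g2 B); have := normr_ge0 (g2 B').
  have := ler_norm (g1 B); have := lerNnormlW (lexx `|g1 B'|); lra.
have bound2 B B' : - (2 * K) <= g2 B' - g2 B.
  have := KB B; have := KB B'; have := normr_ge0 (g1 B); have := normr_ge0 (g1 B').
  have := ler_norm (g2 B); have := lerNnormlW (lexx `|g2 B'|); lra.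
have yY t : - Y <= y t <= Y by rewrite -ler_norml Yt.
have Y0 : 0 <= Y by rewrite sumr_ge0.
have K0 : 0 <= K by apply: le_trans (KB (t0 |: S)); apply: addr_ge0.
clearbody K Y.
pose h1 B := g1 B - dotB x B; pose h2 B := g2 B - dotB x B.
pose B1 := t0 |: S; pose B2 := T :\ t0.
have loc1 u v : u \in B1 -> v \notin B1 -> basis d1 m1 (swap B1 u v) ->
    h1 B1 <= h1 (swap B1 u v) /\ (h1 (swap B1 u v) = h1 B1 -> [/\ u = t0, v \in T :\: S &
      (m1 (v |: S) + m2 (T :\ v) = m1 (t0 |: S) + m2 (T :\ t0))%E]).
  move=> uB vB; rewrite /h1 dotB_swap //; have := bound1 B1 (swap B1 u v).
  have uB' : (u == t0) || (u \in S) by move: uB; rewrite !inE.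
  have [vt0 vS] : v != t0 /\ v \notin S by apply/andP; move: vB; rewrite !inE negb_or.
  case: (boolP (v \in T)) => vT; last first.
    rewrite (xT _ vT); case: (eqVneq u t0) uB' => [->|_] /= uS; first rewrite x0;
      last rewrite xS //; by rewrite /L => h _; split; lra.
  have vU : v \in T :\: S by rewrite inE vS.
  rewrite (xU _ vU vt0); have := yY v.
  case: (eqVneq u t0) uB' => [->|_] /= uS; last first.
    by rewrite xS // /L => /andP[? ?] h _; split; lra.
  rewrite x0; have -> : swap B1 t0 v = v |: S by rewrite /swap finset.setU1K // U_S.
  move=> _ _ bv; have {}bv : b1 v by []; rewrite /y bv; have lh := lohi _ vU bv.
  case: ifP => [b2v|_]; last by rewrite /hi; split; rewrite /B1; lra.
  have [lh1 lh2] := lh b2v; rewrite -/(g1 _) -/(g1 (v |: S)).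
  have hE : g1 (v |: S) = hi v + g1 B1 by rewrite /hi /B1; ring.
  by rewrite hE; split; [lra|move=> e; split=> //; apply: lh2; lra].
have loc2 u v : u \in B2 -> v \notin B2 -> basis d2 m2 (swap B2 u v) ->
    h2 B2 <= h2 (swap B2 u v) /\ (h2 (swap B2 u v) = h2 B2 -> [/\ v = t0, u \in T :\: S &
      (m1 (u |: S) + m2 (T :\ u) = m1 (t0 |: S) + m2 (T :\ t0))%E]).
  move=> uB vB; rewrite /h2 dotB_swap //; have := bound2 B2 (swap B2 u v).
  have [ut0 uT] : u != t0 /\ u \in T by apply/andP; move: uB; rewrite !inE.
  have vB' : (v == t0) || (v \notin T) by move: vB; rewrite !inE negb_and negbK.
  case: (boolP (u \in S)) => uS.
    rewrite (xS _ uS); case: (eqVneq v t0) vB' => [->|_] /= vT; first rewrite x0;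
      last rewrite xT //; by rewrite /L => h _; split; lra.
  have uU : u \in T :\: S by rewrite inE uS.
  rewrite (xU _ uU ut0); have := yY u.
  case: (eqVneq v t0) vB' => [->|_] /= vT; last first.
    by rewrite xT // /L => /andP[? ?] h _; split; lra.
  rewrite x0; have -> : swap B2 u t0 = T :\ u.
    apply/setP => k; rewrite !inE; case: (eqVneq k t0) => [->|_] //=.
    by rewrite eq_sym ut0 (U_T _ t0U).
  move=> _ _ bu; have {}bu : b2 u by []; rewrite /y bu; have lh := lohi _ uU.
  have hE : g2 (T :\ u) = g2 B2 - lo u by rewrite /lo /B2; ring.
  rewrite -/(g2 (T :\ u)) hE.
  case: ifP => [b1u|_]; last by split; lra.
  have [lh1 lh2] := lh b1u bu.
  by split; [lra|move=> e; split=> //; apply: lh2; lra].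
have vx1 := valuated_exchange_shift x (valuated_matroid_exchange vm1).
have vx2 := valuated_exchange_shift x (valuated_matroid_exchange vm2).
have sz1 B : basis d1 m1 B -> #|B| = d1 by case/andP => /eqP.
have sz2 B : basis d2 m2 B -> #|B| = d2 by case/andP => /eqP.
have glob1 : forall B, basis d1 m1 B -> h1 B1 <= h1 B.
  by apply: (local_optimum sz1 vx1 b10) => u v uB vB /(loc1 _ _ uB vB)[].
have glob2 : forall B, basis d2 m2 B -> h2 B2 <= h2 B.
  by apply: (local_optimum sz2 vx2 b20) => u v uB vB /(loc2 _ _ uB vB)[].
have min1 : minimizer d1 m1 x B1 by apply/(minimizerP _ _ vm1).
have min2 : minimizer d2 m2 x B2 by apply/(minimizerP _ _ vm2).
exists x; split=> // B /minimizerP.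
  move=> /(_ vm1)[bB minB].
  have hB : h1 B1 = h1 B by apply/eqP; rewrite eq_le glob1 //= minB.
  case: (eqVneq B1 B) => [<-|B1B]; first by exists t0.
  (* By [loc1] an exchange between optima always takes [t0] out of [B1], and the optimum
     [swap B v u] contains [t0] again. A second exchange would have to remove an element absent from
     it, so it equals [B1]. *)
  have [u [v [uB vB P1 e1 [P2 e2]]]] := optimum_exchange sz1 vx1 b10 bB hB B1B glob1.
  have [/finset.setDP[uB1 uB'] /finset.setDP[vB' vB1]] := conj uB vB.
  have [ut0 vU lv] := (loc1 _ _ uB1 vB1 P1).2 e1.
  case: (eqVneq B1 (swap B v u)) => [B1e|B1e].
    exists v => //; split=> //; apply/setP => k; have /setP/(_ k) := B1e.
    rewrite !inE; move: vB1 uB'; rewrite ut0 !inE.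
    case: (eqVneq k v) => [->|kv] /=; first by rewrite vB'.
    case: (eqVneq k t0) => [->|kt] //= ? /negbTE-> _; by rewrite (negbTE (U_S _ t0U)).
  have [u' [v' [uB2 vB2 P1' e1' _]]] :=
    optimum_exchange sz1 vx1 b10 P2 (esym e2) B1e glob1.
  have [/finset.setDP[uB21 uB2'] /finset.setDP[vB2' vB21]] := conj uB2 vB2.
  have [ut0' _ _] := (loc1 _ _ uB21 vB21 P1').2 e1'.
  by move: uB2'; rewrite ut0' -ut0 !inE eqxx.
move=> /(_ vm2)[bB minB].
have hB : h2 B2 = h2 B by apply/eqP; rewrite eq_le glob2 //= minB.
case: (eqVneq B2 B) => [<-|B2B]; first by exists t0.
(* Dually, every exchange inserts [t0] into [B2], and [swap B v u] has already lost [t0]. *)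
have [u [v [uB vB P1 e1 [P2 e2]]]] := optimum_exchange sz2 vx2 b20 bB hB B2B glob2.
have [/finset.setDP[uB1 uB'] /finset.setDP[vB' vB1]] := conj uB vB.
have [vt0 uU lu] := (loc2 _ _ uB1 vB1 P1).2 e1.
case: (eqVneq B2 (swap B v u)) => [B2e|B2e].
  exists u => //; split=> //; apply/setP => k; have /setP/(_ k) := B2e.
  rewrite !inE; move: vB' uB'; rewrite vt0.
  case: (eqVneq k u) => [->|ku] /=; first by move=> _ /negbTE->.
  by case: (eqVneq k t0) => [->|kt] //= -> _ _; rewrite (U_T _ t0U).
have [u' [v' [uB2 vB2 P1' e1' _]]] :=
  optimum_exchange sz2 vx2 b20 P2 (esym e2) B2e glob2.
have [/finset.setDP[uB21 uB2'] /finset.setDP[vB2' vB21]] := conj uB2 vB2.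
have [vt0' _ _] := (loc2 _ _ uB21 vB21 P1').2 e1'.
move: vB2'; rewrite vt0' -vt0 !inE eqxx /= orbF => /eqP e.
by move: uB'; rewrite -e vB'.
Qed.
End ValuatedMatroid.

(** * Flag polytopes determine their constituents *)

Section Polytopes.
Variables (R : realType) (n : nat).
Implicit Types (y : 'I_n -> R) (p v : 'rV[R]_n) (B C W : {set 'I_n}) (V : set 'rV[R]_n).

Definition dotp y p : R := \sum_k y k * p 0 k.
Definition weight y B : R := \sum_(k in B) y k.

Lemma dotp_sum y (I : finType) (c : I -> R) (v : I -> 'rV[R]_n) :
  dotp y (\sum_i c i *: v i) = \sum_i c i * dotp y (v i).
Proof.
rewrite /dotp; under eq_bigr => k _ do rewrite summxE mulr_sumr.
rewrite exchange_big; apply: eq_bigr => i _; rewrite mulr_sumr.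
by apply: eq_bigr => k _; rewrite mxE mulrCA.
Qed.

Lemma dotp_sum1 y (I : finType) (v : I -> 'rV[R]_n) :
  dotp y (\sum_i v i) = \sum_i dotp y (v i).
Proof.
have := dotp_sum y (fun=> 1) v.
under eq_bigr do rewrite scale1r; move=> ->; by under eq_bigr do rewrite mul1r.
Qed.

Lemma dotp_eB y B : dotp y (eB R B) = weight y B.
Proof.
rewrite /dotp /weight [RHS]big_mkcond; apply: eq_bigr => k _; rewrite mxE.
by case: (k \in B); rewrite ?mulr1 ?mulr0.
Qed.

Lemma conv_sub V v : V v -> conv V v.
Proof.
move=> Vv; exists 1%N, (fun=> 1), (fun=> v); split=> //; rewrite big_ord1 //.
by rewrite scale1r.
Qed.

Lemma conv_nonempty V p : conv V p -> exists v, V v.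
Proof.
move=> [[|m] [c [v [c0 c1 Vv _]]]]; last by exists (v ord0).
by move/eqP: c1; rewrite big_ord0 eq_sym oner_eq0.
Qed.

Lemma conv_le V y c p : (forall v, V v -> dotp y v <= c) -> conv V p -> dotp y p <= c.
Proof.
move=> Vc [m [a [v [a0 a1 Vv ->]]]]; rewrite dotp_sum -[c]mul1r -a1 mulr_suml.
by apply: ler_sum => i _; apply: (ler_wpM2l (a0 i)); apply: Vc.
Qed.

Lemma conv_face V y c v0 p : (forall v, V v -> dotp y v <= c) ->
  (forall v, V v -> dotp y v = c -> v = v0) -> conv V p -> dotp y p = c ->
  p = v0 /\ V v0.
Proof.
move=> Vc Vu [m [a [v [a0 a1 Vv ->]]]]; rewrite dotp_sum => e.
have z i : a i * (c - dotp y (v i)) = 0.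
  have : \sum_i a i * (c - dotp y (v i)) == 0.
    under eq_bigr do rewrite mulrBr.
    by rewrite sumrB e -mulr_suml a1 mul1r subrr.
  rewrite psumr_eq0 => [/allP/(_ i)|j _]; last by rewrite mulr_ge0 // subr_ge0 Vc.
  by rewrite mem_index_enum => /(_ isT)/eqP.
have vE i : a i = 0 \/ v i = v0.
  have /eqP := z i; rewrite mulf_eq0 subr_eq0 => /orP[/eqP|/eqP]; first by left.
  by move=> /esym h; right; apply: Vu.
split.
  transitivity (\sum_i a i *: v0); last by rewrite -scaler_suml a1 scale1r.
  by apply: eq_bigr => i _; case: (vE i) => ->; rewrite ?scale0r.
have [i ai] : exists i, a i != 0.
  apply: contrapT => h; move/eqP: a1; rewrite big1 ?(eq_sym 0) ?oner_eq0 // => i _.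
  by apply/eqP; apply: contrapT => /negP ai; apply: h; exists i.
by case: (vE i) => [e0|<-//]; rewrite e0 eqxx in ai.
Qed.

(** Cancel the common elements; the differences have equal size, and the least weight on [W :\: B]
    separates them. *)
Lemma weight_separated y W B : (forall a b, a \in W -> b \notin W -> y b < y a) ->
  #|B| = #|W| -> weight y B <= weight y W /\ (weight y B = weight y W -> B = W).
Proof.
move=> sep c; case: (eqVneq B W) => [->//|BW].
suff lt : weight y B < weight y W.
  by split=> [|e]; [apply: ltW | rewrite e ltxx in lt].
have [a0 a0P] : exists a, a \in W :\: B by apply: setD_neq0 => //; rewrite eq_sym.
have [b0 b0P] : exists b, b \in B :\: W by apply: setD_neq0.
have -> : weight y W = weight y (W :&: B) + weight y (W :\: B).
  by rewrite /weight (big_setID B).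
have -> : weight y B = weight y (W :&: B) + weight y (B :\: W).
  by rewrite /weight (big_setID W) /= finset.setIC.
rewrite ltrD2l.
case: (@arg_minP _ _ _ a0 (fun a => a \in W :\: B) y a0P) => a aP amin.
have cD : #|B :\: W| = #|W :\: B|.
  by apply/eqP; rewrite -(eqn_add2l #|W :&: B|) cardsID finset.setIC cardsID c.
apply: (@lt_le_trans _ _ (\sum_(b in B :\: W) y a)).
  rewrite /weight; apply: ltr_sum => [|b].
    by apply/hasP; exists b0; rewrite ?mem_index_enum.
  by rewrite inE => /andP[bW _]; apply: sep => //; move: aP; rewrite inE => /andP[].
rewrite sumr_const cD -sumr_const; apply: ler_sum => b; exact: amin.
Qed.

Lemma sum_pow2_lt (f : 'I_n -> nat) B m : injective f ->
  (forall k, k \in B -> (f k < m)%N) -> (\sum_(k in B) 2 ^ f k < 2 ^ m)%N.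
Proof.
move=> finj; elim: m B => [|m IH] B Bm.
  by rewrite big_pred0 // => k; apply/negbTE/negP => /Bm.
rewrite (bigID (fun k => f k == m)) /= expnS mul2n -addnn -addnS.
apply: leq_add; last first.
  have -> : (\sum_(k in B | f k != m) 2 ^ f k =
             \sum_(k in [set k in B | f k != m]%SET) 2 ^ f k)%N.
    by apply: eq_bigl => k; rewrite inE.
  by apply: IH => k; rewrite inE => /andP[/Bm]; rewrite ltnS leq_eqVlt => /orP[->|].
case: (pickP (fun k => (k \in B) && (f k == m))) => [k0 /andP[k0B /eqP k0m]|no].
  rewrite (big_pred1 k0) ?k0m // => k /=; apply/andP/eqP => [[_ /eqP]|->].
    by rewrite -k0m => /finj.
  by rewrite k0B k0m.
by rewrite big_pred0.
Qed.

(** Distinct powers of two give different sets different weights; the shift by [n] places [B0] above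
    its complement, so [B0] is the unique heaviest set of its size. *)
Definition priority B0 (k : 'I_n) : R := (2 ^ (k + (k \in B0) * n))%:R.

Lemma weight_priority_inj B0 B B' :
  weight (priority B0) B = weight (priority B0) B' -> B = B'.
Proof.
pose f (k : 'I_n) := (k + (k \in B0) * n)%N.
have finj : injective f.
  move=> a b; rewrite /f => e; apply: val_inj => /=; have := ltn_ord a; have := ltn_ord b.
  by move: e; case: (a \in B0); case: (b \in B0); rewrite ?mul1n ?mul0n; lia.
have wE C : weight (priority B0) C = (\sum_(k in C) 2 ^ f k)%:R.
  by rewrite /weight natr_sum.
have main B1 B2 a : (\sum_(k in B1) 2 ^ f k = \sum_(k in B2) 2 ^ f k)%N ->
    a \in B1 :\: B2 -> (forall b, b \in B2 :\: B1 -> (f b <= f a)%N) -> False.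
  move=> e aB amax; move: e; rewrite (big_setID B2) [RHS](big_setID B1) /= finset.setIC.
  move/addnI; rewrite (big_setD1 a aB) /= => e.
  have : (\sum_(k in B2 :\: B1) 2 ^ f k < 2 ^ f a)%N.
    apply: sum_pow2_lt => // k kB; rewrite ltn_neqAle amax ?andbT //.
    apply/negP => /eqP/finj ka; move: aB kB; rewrite ka !inE.
    by case/andP=> /negbTE->; rewrite andbF.
  by rewrite -e ltnNge leq_addr.
rewrite !wE => /eqP; rewrite eqr_nat => /eqP e; apply: contrapT => /eqP BB'.
pose D := (B :\: B') :|: (B' :\: B).
have [a0 a0D] : exists a, a \in D.
  apply/set0Pn; apply: contra BB'; rewrite finset.setU_eq0 !finset.setD_eq0 => /andP[s1 s2].
  by rewrite finset.eqEsubset s1.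
case: (@arg_maxnP _ a0 (fun a => a \in D) f a0D) => a aD amax.
case/finset.setUP: (aD) => aB.
  by apply: (main B B' a e aB) => b bB; apply: amax; apply/finset.setUP; right.
by apply: (main B' B a (esym e) aB) => b bB; apply: amax; apply/finset.setUP; left.
Qed.

Lemma priority_separated B0 a b : a \in B0 -> b \notin B0 -> priority B0 b < priority B0 a.
Proof.
move=> aB /negbTE bB; rewrite /priority ltr_nat ltn_exp2l // aB bB mul0n mul1n addn0.
by apply: leq_trans (ltn_ord b) _; rewrite leq_addl.
Qed.

Variables (s : nat) (d : 'I_s -> nat).
Implicit Types (Fam : 'I_s -> set {set 'I_n}) (Ch : 'I_s -> {set 'I_n}).

Definition flag_polytope Fam : set 'rV[R]_n :=
  msum (fun j => conv [set eB R B | B in Fam j]).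

Lemma flag_polytope_sum Fam Ch : (forall j, Fam j (Ch j)) ->
  flag_polytope Fam (\sum_j eB R (Ch j)).
Proof.
move=> FC; exists (fun j => eB R (Ch j)); split=> // j; apply: conv_sub; exists (Ch j) => //.
Qed.

Lemma flag_polytope_le Fam Ch y p : (forall j B, Fam j B -> weight y B <= weight y (Ch j)) ->
  flag_polytope Fam p -> dotp y p <= \sum_j weight y (Ch j).
Proof.
move=> le [q [qF ->]]; rewrite dotp_sum1; apply: ler_sum => j _.
by apply: conv_le (qF j) => _ [B FB <-]; rewrite dotp_eB; apply: le.
Qed.

Lemma flag_polytope_face Fam Ch y p :
  (forall j B, Fam j B -> weight y B <= weight y (Ch j)) ->
  (forall j B, Fam j B -> weight y B = weight y (Ch j) -> B = Ch j) ->
  flag_polytope Fam p -> dotp y p = \sum_j weight y (Ch j) ->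
  p = \sum_j eB R (Ch j) /\ forall j, Fam j (Ch j).
Proof.
move=> le un [q [qF ->]]; rewrite dotp_sum1 => e.
have leq j : dotp y (q j) <= weight y (Ch j).
  by apply: conv_le (qF j) => _ [B FB <-]; rewrite dotp_eB; apply: le.
have eq j : dotp y (q j) = weight y (Ch j).
  have /(@psumr_eq0P _ _ _ _)-/(_ _ j isT) : \sum_j (weight y (Ch j) - dotp y (q j)) = 0.
    by rewrite sumrB e subrr.
  by move=> h; apply/eqP; rewrite eq_sym -subr_eq0 h // => i _; rewrite subr_ge0.
have key j : q j = eB R (Ch j) /\ Fam j (Ch j).
  have [||->] := conv_face _ _ (qF j) (eq j) (v0 := eB R (Ch j)).
  - by move=> _ [B FB <-]; rewrite dotp_eB; apply: le.
  - by move=> _ [B FB <-]; rewrite dotp_eB => /(un _ _ FB)->.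
  case=> B FB eBB; split=> //; suff <- : B = Ch j by [].
  apply/setP => k; have := congr1 (fun v : 'rV[R]_n => v 0 k) eBB; rewrite !mxE => /eqP.
  by rewrite eqr_nat; case: (k \in B); case: (k \in Ch j).
by split=> [|j]; [apply: eq_bigr => j _|]; have [] := key j.
Qed.

(* The weight counting the members of the chain that contain an element is maximised,
   among the sets of the size of [Ch j], at [Ch j] only. *)
Lemma flag_polytope_chain Fam Ch : (forall j B, Fam j B -> #|B| = #|Ch j|) ->
  (forall j k : 'I_s, (j <= k)%N -> Ch j \subset Ch k) ->
  flag_polytope Fam (\sum_j eB R (Ch j)) -> forall j, Fam j (Ch j).
Proof.
move=> FC nest inP; pose y k : R := #|[set j : 'I_s | k \in Ch j]%SET|%:R.
have sep j a b : a \in Ch j -> b \notin Ch j -> y b < y a.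
  move=> aj bj; rewrite /y ltr_nat; apply: proper_card; apply/properP; split.
    apply/fintype.subsetP => i; rewrite !inE => bi.
    have ji : (j <= i)%N.
      by rewrite leqNgt; apply: contra bj => /ltnW/nest/fintype.subsetP; apply.
    exact: (fintype.subsetP (nest _ _ ji)).
  by exists j; rewrite !inE.
have W j B (FB : Fam j B) := weight_separated (sep j) (FC j B FB).
have h : dotp y (\sum_j eB R (Ch j)) = \sum_j weight y (Ch j).
  by rewrite dotp_sum1; apply: eq_bigr => j _; rewrite dotp_eB.
apply: (flag_polytope_face _ _ inP h).2; first by move=> j B /W[].
by move=> j B /W[].
Qed.

Lemma exists_maximum (Q : set {set 'I_n}) y : (exists B, Q B) ->
  exists B, Q B /\ forall B', Q B' -> weight y B' <= weight y B.
Proof.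
case=> B QB; have QB' : `[< Q B >] by apply/asboolP.
case: (@arg_maxP _ _ _ B (fun B => `[< Q B >]) (weight y) QB') => C /asboolP QC Cmax.
by exists C; split=> // B' QB1; apply: Cmax; apply/asboolP.
Qed.

Definition flag_exchange Fam := forall (j k : 'I_s) B C u, (j < k)%N -> Fam j B -> Fam k C ->
  u \in B :\: C -> exists t, [/\ t \in C :\: B, Fam j (swap B u t) & Fam k (swap C t u)].

Lemma weight_swap y B u t : u \in B -> t \notin B ->
  weight y (swap B u t) = weight y B - y u + y t.
Proof.
move=> uB tB; rewrite /weight /swap big_setU1 ?inE ?negb_and ?tB ?orbT //=.
by rewrite (big_setD1 u uB) /=; ring.
Qed.

(** An exchange between two maxima changes their weights by opposite amounts. Neither may gain, so
    [y u = y t], against injectivity. *)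
Lemma maxima_nested Fam Ch y : injective y -> flag_exchange Fam ->
  (forall j, Fam j (Ch j)) -> (forall j B, Fam j B -> weight y B <= weight y (Ch j)) ->
  forall j k : 'I_s, (j <= k)%N -> Ch j \subset Ch k.
Proof.
move=> yinj ex FC Cmax j k; rewrite leq_eqVlt => /orP[/eqP/val_inj->//|jk].
rewrite -finset.setD_eq0; apply/set0Pn => -[u uB].
have [t [tC F1 F2]] := ex j k _ _ u jk (FC j) (FC k) uB.
have := Cmax _ _ F1; have := Cmax _ _ F2.
have /finset.setDP[uj uk] := uB; have /finset.setDP[tk tj] := tC.
rewrite !weight_swap // => h1 h2.
have e : y u = y t by lra.
by move: tj; rewrite -(yinj _ _ e) uj.
Qed.

(** Exchange is asked of [Nat] alone. For the weight [priority B], the maxima of [Nat] are nested,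
    hence lie in [Fam] by [flag_polytope_chain]. If [B] is in [Nat], it is one of these maxima. *)
Lemma flag_polytope_inj Fam Nat : (forall j B, Fam j B -> #|B| = d j) ->
  (forall j B, Nat j B -> #|B| = d j) -> (forall j, exists B, Fam j B) ->
  flag_exchange Nat -> flag_polytope Fam = flag_polytope Nat ->
  forall j B, Fam j B <-> Nat j B.
Proof.
move=> Fd Nd F0 Nex FN.
have N0 j : exists B, Nat j B.
  have [Ch ChF] := choice F0; have := flag_polytope_sum ChF; rewrite FN.
  by case=> q [/(_ j)/conv_nonempty[_ [B NB _]] _]; exists B.
have yinj B0 : injective (priority B0).
  move=> a b e; have : [set a]%SET = [set b]%SET.
    by apply: (@weight_priority_inj B0); rewrite /weight !big_set1.
  by move/setP/(_ a); rewrite !inE eqxx => /esym/eqP.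
have top i B (Q : set {set 'I_n}) C : (forall B, Q B -> #|B| = d i) -> Q B -> Q C ->
    (forall B', Q B' -> weight (priority B) B' <= weight (priority B) C) -> C = B.
  move=> Qd QB QC Cmax; have cC : #|C| = #|B| by rewrite !Qd.
  have [le eq] := weight_separated (@priority_separated B) cC.
  by apply: eq; apply/eqP; rewrite eq_le le Cmax.
move=> i B.
have [W' W'P] := choice (fun j => exists_maximum (priority B) (N0 j)).
have W'N j : Nat j (W' j) by have [] := W'P j.
have W'max j C : Nat j C -> weight (priority B) C <= weight (priority B) (W' j).
  by have [_] := W'P j; apply.
have W'F : forall j, Fam j (W' j).
  apply: flag_polytope_chain.
  - by move=> j C FC; rewrite (Fd _ _ FC) (Nd _ _ (W'N j)).
  - exact: maxima_nested (yinj B) Nex W'N W'max.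
  - by rewrite FN; apply: flag_polytope_sum.
split=> [FB|NB]; last first.
  by have <- : W' i = B by apply: (top i B (Nat i)) => //; [apply: Nd|apply: W'max].
have [W WP] := choice (fun j => exists_maximum (priority B) (F0 j)).
have WF j : Fam j (W j) by have [] := WP j.
have Wmax j C : Fam j C -> weight (priority B) C <= weight (priority B) (W j).
  by have [_] := WP j; apply.
have WB : W i = B by apply: (top i B (Fam i)) => //; [apply: Fd|apply: Wmax].
have le1 : dotp (priority B) (\sum_j eB R (W j)) <= \sum_j weight (priority B) (W' j).
  by apply: (flag_polytope_le W'max); rewrite -FN; apply: flag_polytope_sum.
have /(@psumr_eq0P _ _ _ _)-/(_ _ i isT) :
    \sum_j (weight (priority B) (W j) - weight (priority B) (W' j)) = 0.
  apply/eqP; rewrite eq_le; apply/andP; split.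
    move: le1; rewrite dotp_sum1 sumrB subr_le0; congr (_ <= _).
    by apply: eq_bigr => j _; rewrite dotp_eB.
  by apply: sumr_ge0 => j _; rewrite subr_ge0; apply: Wmax.
move=> h; have {h} : weight (priority B) (W i) - weight (priority B) (W' i) = 0.
  by apply: h => j _; rewrite subr_ge0; apply: Wmax.
by move/eqP; rewrite subr_eq0 => /eqP/weight_priority_inj; rewrite WB => ->.
Qed.
End Polytopes.

(** * Flag positroid subdivisions *)

Section Positroids.
Variables (R : realType) (n s : nat) (d : 'I_s -> nat).
Variable mu : 'I_s -> {set 'I_n} -> \bar R.
Implicit Types (B C S T : {set 'I_n}) (i j k : 'I_s) (t : 'I_n).
Hypothesis mu_flag : valuated_flag_matroid d mu.

Definition cell_bases (x : 'rV[R]_n) j : set {set 'I_n} :=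
  [set B | minimizer (d j) (mu j) x B].

Lemma cellE x : cell d mu x = flag_polytope (cell_bases x).
Proof. by []. Qed.

Lemma lambda_weight i i' S T t0 : plucker_pair d i i' S T ->
  t0 \in T :\: S -> lambda mu i i' S T t0 != +oo%E ->
  (forall t, t \in T :\: S -> (lambda mu i i' S T t0 <= lambda mu i i' S T t)%E) ->
  exists x, [/\ cell_bases x i (t0 |: S), cell_bases x i' (T :\ t0),
    forall B, cell_bases x i B -> exists2 t, t \in T :\: S & B = t |: S /\
      lambda mu i i' S T t = lambda mu i i' S T t0 &
    forall B, cell_bases x i' B -> exists2 t, t \in T :\: S & B = T :\ t /\
      lambda mu i i' S T t = lambda mu i i' S T t0].
Proof.
move=> pp; have [dP vm _] := mu_flag; have [ST _ _ cS cT] := plucker_pair_card dP pp.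
exact: weight_vector.
Qed.

Lemma plucker_vector_minor (A : nat -> 'I_n -> R) : plucker_vector (minor A).
Proof. by move=> S T ST; apply: plucker_relation. Qed.


Lemma exists_cell_basis x j : exists B, cell_bases x j B.
Proof.
have [_ vm _] := mu_flag; have [_ [B0 [cB0 mB0]] _] := vm j.
have b0 : basis (d j) (mu j) B0 by rewrite /basis cB0 eqxx.
case: (@arg_minP _ _ _ B0 (basis (d j) (mu j)) (fun B => fine (mu j B) - dotB x B) b0).
by move=> B bB Bmin; exists B; apply/(minimizerP _ _ (vm j)).
Qed.

Lemma flag_positroid_bases x : flag_positroid_polytope d (cell d mu x) ->
  exists2 A : nat -> 'I_n -> R,
    forall j, exists2 c : R, c != 0 & forall B : {set 'I_n}, #|B| = d j -> 0 <= c * minor A B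
  & forall j B, cell_bases x j B <-> #|B| = d j /\ minor A B != 0.
Proof.
have [dP vm _] := mu_flag.
case=> A [_ Apos cellA]; exists A; first by move=> j; have [c []] := Apos j; exists c.
apply: (@flag_polytope_inj _ _ _ d (cell_bases x)
  (fun j => [set B : {set 'I_n} | #|B| = d j /\ minor A B != 0])).
- by move=> j B [].
- by move=> j B [].
- exact: exists_cell_basis.
- move=> j k B C u jk [cB nB] [cC nC] uBC; have /finset.setDP[uB uC] := uBC.
  have cS : #|B :\ u|.+1 = d j by have := cardsD1 u B; rewrite uB cB.
  have [||||t [tT tu nt1 nt2]] := plucker_exchange (plucker_vector_minor A) (S := B :\ u)
      (T := u |: C) (t := u).
  + by rewrite cS cardsU1 uC cC add1n ltnS ltnW ?dP.
  + by rewrite !inE eqxx.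
  + by rewrite finset.setD1K.
  + by rewrite finset.setU1K.
  have [tB tC] : t \notin B /\ t \in C.
    by move: tT; rewrite !inE (negbTE tu) /= => /andP[].
  exists t; split; [by rewrite inE tB|split=> //|split].
  + by rewrite card_swap.
  + by rewrite card_swap.
  + suff <- : (u |: C) :\ t = swap C t u by [].
    apply/setP => a; rewrite !inE; case: (eqVneq a t) => [->|_] //=.
    by rewrite (negbTE tu).
- exact: cellA.
Qed.

Lemma flag_positroid_lambda i i' S T t0 :
  flag_positroid_subdivision d mu -> plucker_pair d i i' S T ->
  t0 \in T :\: S -> lambda mu i i' S T t0 != +oo%E ->
  (forall t, t \in T :\: S -> (lambda mu i i' S T t0 <= lambda mu i i' S T t)%E) ->
  exists t, [/\ t \in T :\: S, odd (below (T :\: S) t) = ~~ odd (below (T :\: S) t0) &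
    lambda mu i i' S T t = lambda mu i i' S T t0].
Proof.
move=> pos pp t0U fin0 opt0; have [dP vm _] := mu_flag.
have [ST cST _ cS cT] := plucker_pair_card dP pp.
have [x [b1 b2 u1 u2]] := lambda_weight pp t0U fin0 opt0.
have [A Apos AE] := flag_positroid_bases (pos x).
(* Each constituent has its own scalar making its minors non-negative; both are absorbed into
   [F]. *)
have [c c0 cA] := Apos i; have [c' c'0 c'A] := Apos i'.
set U := T :\: S in t0U *.
have c1 t : t \in U -> #|t |: S| = d i.
  by move=> /finset.setDP[_ tS]; rewrite cardsU1 tS add1n.
have c2 t : t \in U -> #|T :\ t| = d i'.
  by move=> /finset.setDP[tT _]; have := cardsD1 t T; rewrite tT cT => -[].
pose F t := (c * minor A (t |: S)) * (c' * minor A (T :\ t)).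
have F0 t : t \in U -> 0 <= F t by move=> tU; apply: mulr_ge0; [apply/cA/c1|apply/c'A/c2].
have Frel : \sum_(t in U) (-1) ^+ below U t * F t = 0.
  transitivity (c * c' * \sum_(t in U) (-1) ^+ below U t *
      (minor A (t |: S) * minor A (T :\ t))); last first.
    by rewrite (plucker_sub (plucker_vector_minor A)) // mulr0.
  by rewrite mulr_sumr; apply: eq_bigr => t _; rewrite /F; ring.
have Fn0 : F t0 != 0.
  have [_ n1] := (AE _ _).1 b1; have [_ n2] := (AE _ _).1 b2.
  by rewrite /F !mulf_neq0.
have [t [tU ot Ft]] : exists t, [/\ t \in U, odd (below U t) = ~~ odd (below U t0) & F t != 0].
  (* If all non-zero terms had the parity of [t0], the relation would be, up to sign, a sum of
     non-negative terms, among them [F t0 != 0]. *)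
  apply: contrapT => no.
  have : \sum_(t in U) F t == 0.
    apply/eqP; apply: (can_inj (signrMK (below U t0))).
    rewrite mulr0 -[RHS]Frel mulr_sumr.
    apply: eq_bigr => t tU; case: (eqVneq (F t) 0) => [->|Ft]; first by rewrite !mulr0.
    rewrite -signr_odd -[in RHS]signr_odd; congr (_ ^+ _ * _).
    case: (eqVneq (odd (below U t)) (odd (below U t0))) => [->//|o].
    by case: no; exists t; split=> //; move: o; case: odd; case: odd.
  rewrite psumr_eq0 => [/allP/(_ t0)|t tU]; last exact: F0.
  by rewrite mem_index_enum t0U (negbTE Fn0) => /(_ isT).
have mn0 : minor A (t |: S) != 0.
  by move: Ft; rewrite /F !mulf_eq0 !negb_or => /andP[/andP[]].
have [t' t'U [e lt']] := u1 _ ((AE _ _).2 (conj (c1 _ tU) mn0)).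
exists t; split=> //; rewrite -lt'; suff -> : t = t' by [].
have /finset.setDP[_ tS] := tU.
have : t \in t' |: S by rewrite -e setU11.
by rewrite !inE (negbTE tS) orbF => /eqP.
Qed.
End Positroids.

(** * Bruhat intervals *)

Section Bruhat.
Variable n : nat.
Local Open Scope nat_scope.
Implicit Types (u v w : {perm 'I_n}) (p q : nat) (a b k m : 'I_n).

Definition rk u p q : nat := \sum_(k < n) ((k < p) && (q <= u k)).
(** The rank-matrix form of Bruhat order; [bruhat_le_rk] and [rk_bruhat_le] show that it agrees with
    [bruhat_le]. *)
Definition rk_le u v : Prop := forall p q, rk u p q <= rk v p q.

Lemma rk_trans u v w : rk_le u v -> rk_le v w -> rk_le u w.
Proof. by move=> uv vw p q; apply: leq_trans (uv p q) (vw p q). Qed.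

Lemma rk0 u q : rk u 0 q = 0.
Proof. by rewrite /rk big1. Qed.

Lemma rkS u m q : rk u m.+1 q = rk u m q + (q <= u m).
Proof.
rewrite /rk (bigD1 m) //= [in RHS](bigD1 m) //= ltnSn ltnn /= addnC; congr (_ + _).
by apply: eq_bigr => k; rewrite -val_eqE ltnS leq_eqVlt => /negbTE->.
Qed.

Lemma rk_inv u p q : rk u p q = \sum_(c < n) (((u^-1)%g c < p) && (q <= c)).
Proof.
rewrite /rk (reindex_inj (@perm_inj _ (u^-1)%g)); apply: eq_bigr => c _.
by rewrite permKV.
Qed.

Lemma rk_total u v q : rk u n q = rk v n q.
Proof. by rewrite !rk_inv; apply: eq_bigr => c _; rewrite !ltn_ord. Qed.

Lemma rk_box u p0 p q g : p0 <= p -> q <= g ->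
  rk u p q + rk u p0 g =
  rk u p g + rk u p0 q + \sum_(k < n) [&& p0 <= k, k < p, q <= u k & u k < g].
Proof. by move=> p0p qg; rewrite /rk -!big_split; apply: eq_bigr => k _ /=; lia. Qed.

(** Swaps the values at the positions [a] and [b], whereas [bruhat_step] names the swapped
    values. *)
Definition exchange u a b : {perm 'I_n} := (u * tperm (u a) (u b))%g.

Lemma exchangeL u a b : exchange u a b a = u b.
Proof. by rewrite permM tpermL. Qed.
Lemma exchangeR u a b : exchange u a b b = u a.
Proof. by rewrite permM tpermR. Qed.
Lemma exchangeD u a b k : k != a -> k != b -> exchange u a b k = u k.
Proof. by move=> ka kb; rewrite permM tpermD // (inj_eq perm_inj) eq_sym. Qed.

Lemma rk_exchange u a b p q : a < b -> u a < u b ->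
  rk (exchange u a b) p q = rk u p q + [&& a < p, p <= b, u a < q & q <= u b].
Proof.
move=> ab uab; have ba : b != a by rewrite -val_eqE /= gtn_eqF.
rewrite /rk (bigD1 a) //= (bigD1 b) //= [in RHS](bigD1 a) //= [in RHS](bigD1 b) //=.
rewrite exchangeL exchangeR [X in _ + (_ + X) = _](eq_bigr (fun k => (k < p) && (q <= u k) : nat)).
  by lia.
by move=> k /andP[ka kb]; rewrite exchangeD.
Qed.

Lemma exchange_rk_le u a b : a < b -> u a < u b -> rk_le u (exchange u a b).
Proof. by move=> ab uab p q; rewrite rk_exchange // leq_addr. Qed.

(* In [inv_num] and [piB] the set under the cardinality is a classical set. *)
Lemma card_classical_set (I : finType) (P : pred I) :
  #|[set i | P i]| = #|[set i | P i]%SET|.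
Proof.
by apply: eq_card => i; rewrite [in RHS]inE; apply/idP/idP => [/set_mem|] // h; apply/mem_set.
Qed.

(* Transporting inversions by the transposition of positions [a] and [b], and keeping
   in place those it would reverse, is injective and misses the inversion [(a, b)]. *)
Lemma inv_num_exchange u a b : a < b -> u a < u b ->
  inv_num u < inv_num (exchange u a b).
Proof.
move=> ab uab; set w := exchange u a b; pose t := tperm a b.
have wt k : w (t k) = u k.
  rewrite /w /t; case: tpermP => [->|->|/eqP ka /eqP kb].
  - exact: exchangeR.
  - exact: exchangeL.
  - exact: exchangeD.
have tK : involutive t by apply: tpermK.
pose I (x : {perm 'I_n}) := [set z : 'I_n * 'I_n | (z.1 < z.2)%N && (x z.2 < x z.1)%N]%SET.
pose f (z : 'I_n * 'I_n) := if t z.1 < t z.2 then (t z.1, t z.2) else z.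
have f_inj : {in I u &, injective f}.
  move=> [x1 x2] [y1 y2]; rewrite !inE /f /= => /andP[x12 _] /andP[y12 _].
  case: ifP => tx; case: ifP => ty.
  - by case=> /(can_inj tK)-> /(can_inj tK)->.
  - by case=> e1 e2; rewrite -e1 -e2 !tK x12 in ty.
  - by case=> e1 e2; rewrite e1 e2 !tK y12 in tx.
  - by [].
have fI : {subset [set f z | z in I u]%SET <= I w}.
  move=> _ /imsetP[[x y] + ->]; rewrite !inE /f /= => /andP[xy uyx].
  case: ifP => [txy|/negbT]; first by rewrite /= txy !wt.
  rewrite -leqNgt /= xy /= => tyx.
  have [xa|xa] := eqVneq x a.
    rewrite {}xa in xy uyx tyx *; have [yb|yb] := eqVneq y b; first by rewrite yb in uyx; lia.
    have ya : y != a by rewrite -val_eqE /= gtn_eqF.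
    by rewrite /w exchangeL exchangeD //; lia.
  have [xb|xb] := eqVneq x b.
    rewrite {}xb in xy tyx; have ya : y != a by rewrite -val_eqE /= gtn_eqF //; lia.
    have yb : y != b by rewrite -val_eqE /= gtn_eqF.
    by move: tyx; rewrite /t tpermR tpermD 1?eq_sym //; lia.
  have [ya|ya] := eqVneq y a.
    by move: tyx xy; rewrite ya /t tpermL tpermD 1?eq_sym //; lia.
  have [yb|yb] := eqVneq y b.
    by rewrite yb /w exchangeR exchangeD //; rewrite yb in uyx; lia.
  by move: tyx; rewrite /t !tpermD 1?eq_sym //; lia.
have abI : (a, b) \in I w by rewrite inE /= ab /w exchangeL exchangeR.
rewrite /inv_num !card_classical_set -/(I u) -/(I w) -(card_in_imset f_inj); apply: proper_card.
apply/properP; split; first exact/fintype.subsetP.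
exists (a, b) => //; apply/negP => /imsetP[[x y]]; rewrite inE /f /= => /andP[xy uyx].
case: ifP => [_ [e1 e2]|_ [e1 e2]].
  have x_b : x = b by rewrite -(tK x) -e1 /t tpermL.
  have y_a : y = a by rewrite -(tK y) -e2 /t tpermR.
  by rewrite x_b y_a in xy; lia.
by rewrite -e1 -e2 in uyx; lia.
Qed.

Lemma bruhat_step_rk u w : bruhat_step u w -> rk_le u w.
Proof.
case=> a [b [ab we iuw]].
wlog lt_ab : a b ab we / (u^-1)%g a < (u^-1)%g b.
  move=> W; case: (ltngtP ((u^-1)%g a) ((u^-1)%g b)) => [|lt|/val_inj/perm_inj e].
  - exact: W ab we.
  - by apply: W lt; rewrite 1?eq_sym // tpermC.
  - by rewrite e eqxx in ab.
set x := (u^-1)%g a in lt_ab; set y := (u^-1)%g b in lt_ab.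
have ux : u x = a by rewrite permKV.
have uy : u y = b by rewrite permKV.
have {}we : w = exchange u x y by rewrite we /exchange ux uy.
case: (ltngtP (u x) (u y)) => [lt|gt|/val_inj/perm_inj e].
- by rewrite we; apply: exchange_rk_le.
(* Undoing such an exchange would increase [inv_num] from [w] to [u], against the hypothesis of the
   step. *)
- have wxy : w x < w y by rewrite we exchangeL exchangeR.
  have := inv_num_exchange lt_ab wxy.
  have -> : exchange w x y = u.
    by rewrite we {1}/exchange exchangeL exchangeR /exchange -mulgA (tpermC (u y)) tperm2 mulg1.
  by lia.
- by rewrite e ltnn in lt_ab.
Qed.

Lemma bruhat_le_rk u v : bruhat_le u v -> rk_le u v.
Proof.
elim=> [x y /bruhat_step_rk//|x p q //|x y z _ xy _ yz]; exact: rk_trans xy yz.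
Qed.

(** Let [p0] be the last place up to [m] where the ranks at height [u m] agree, and [a] the position
    in [[p0, m)] with the largest value below [u m]. By this choice [u] has no point in the
    rectangles that [rk_box] compares, so the strict gap at height [u m] persists at all heights
    down to just above [u a]. This is exactly the box on which exchanging [a] and [m] adds one to
    the rank. *)
Lemma raise_below u v m : rk_le u v -> rk u m (u m) < rk v m (u m) ->
  exists a, [/\ a < m, u a < u m & forall p q, a < p <= m -> u a < q <= u m ->
    rk u p q < rk v p q].
Proof.
move=> uv Dm; set g := nat_of_ord (u m) in Dm *.
pose Q p := (p <= m) && (rk u p g == rk v p g).
have Q0 : exists p, Q p by exists 0; rewrite /Q !rk0.
have Qm p : Q p -> p <= m by case/andP.
case: (ex_maxnP Q0 Qm) => p0 /andP[p0m /eqP p0e] p0max.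
have {}p0m : p0 < m.
  by rewrite ltn_neqAle p0m andbT; apply/eqP => e; rewrite e in p0e; lia.
have Dg p : p0 < p <= m -> rk u p g < rk v p g.
  move=> /andP[p0p pm]; rewrite ltn_neqAle uv andbT; apply/negP => /eqP e.
  by have := p0max p; rewrite /Q pm e eqxx => /(_ isT); lia.
have p0n : p0 < n by apply: ltn_trans p0m (ltn_ord m).
pose k0 := Ordinal p0n.
have uk0 : u k0 < g.
  have := Dg p0.+1; rewrite ltnSn p0m => /(_ isT).
  have := rkS u k0 g; have := rkS v k0 g => /= -> ->; rewrite p0e; lia.
pose P k := [&& p0 <= k, k < m & u k < g].
have Pk0 : P k0 by rewrite /P leqnn p0m.
case: (@arg_maxnP _ k0 P (fun k => u k) Pk0) => a /and3P[pa am ua] amax.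
exists a; split=> // p q /andP[ap pm] /andP[uaq qg].
have p0p : p0 <= p by lia.
have bu := rk_box u p0p qg; have bv := rk_box v p0p qg.
have z : \sum_(k < n) [&& p0 <= k, k < p, q <= u k & u k < g] = 0.
  apply: big1 => k _; apply/eqP; rewrite eqb0; apply/negP => /and4P[h1 h2 h3 h4].
  have := amax k; rewrite /P h1 h4 (leq_trans h2 pm) => /(_ isT); lia.
have h1 : rk u p g < rk v p g by apply: Dg; lia.
have h2 := uv p0 q; lia.
Qed.

Lemma raise_step u v m : rk_le u v -> rk u m (u m) < rk v m (u m) ->
  exists a, [/\ a < m, u a < u m & rk_le (exchange u a m) v].
Proof.
move=> uv /(raise_below uv)[a [am ua D]]; exists a; split=> // p q.
rewrite rk_exchange //; have := uv p q; have := D p q; lia.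
Qed.

Lemma rk_bruhat_le u v : rk_le u v -> bruhat_le u v.
Proof.
have [N] := ubnP (n * n - inv_num u); elim: N u => // N IH u uN uv.
case: (eqVneq u v) => [->|nuv]; first exact: rt_refl.
have [c0 c0P] : exists c, (u^-1)%g c != (v^-1)%g c.
  apply: contrapT => h; move/eqP: nuv; apply; apply: invg_inj; apply/permP => c.
  by apply/eqP; apply: contrapT => /negP hc; apply: h; exists c.
(* For the largest value [g] placed differently, the ranks above height [g] agree, so [v] must have
   [g] further left than [u]; this yields the strict gap that [raise_step] needs. *)
case: (@arg_maxnP _ c0 (fun c => (u^-1)%g c != (v^-1)%g c) (@nat_of_ord n) c0P) => g gP gmax.
set m := (u^-1)%g g; have um : u m = g by rewrite permKV.
have rkg x p : rk x p g = rk x p g.+1 + ((x^-1)%g g < p).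
  rewrite !rk_inv (bigD1 g) //= [in RHS](bigD1 g) //= leqnn ltnn andbT andbF add0n addnC.
  congr (_ + _); apply: eq_bigr => c cg; congr (_ && _ : nat).
  by rewrite ltn_neqAle -val_eqE eq_sym in cg *; rewrite cg.
have rkSg p : rk u p g.+1 = rk v p g.+1.
  rewrite !rk_inv; apply: eq_bigr => c _; case: (ltnP g c) => gc; last by rewrite !andbF.
  by have := gmax c; case: eqP => [->//|_] /(_ isT); lia.
have lt_vu : (v^-1)%g g < m.
  rewrite ltn_neqAle val_eqE eq_sym gP /= -ltnS.
  have := uv m.+1 g; rewrite !rkg rkSg -/m ltnSn; lia.
have Dm : rk u m (u m) < rk v m (u m).
  by rewrite um !rkg rkSg -/m ltnn lt_vu; lia.
have [a [am uam wv]] := raise_step uv Dm.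
have inv_lt := inv_num_exchange am uam.
have inv_max (x : {perm 'I_n}) : inv_num x <= n * n.
  by rewrite /inv_num card_classical_set (leq_trans (max_card _)) // card_prod !card_ord.
apply: (@rt_trans _ _ _ (exchange u a m)).
  apply: rt_step; exists (u a), (u m); split=> //.
  by rewrite (inj_eq perm_inj) -val_eqE /= ltn_eqF.
by apply: IH => //; have := inv_max (exchange u a m); lia.
Qed.

(** Iterates [raise_step] at [m]. Each step lowers the value there and leaves the ranks before [m]
    unchanged at the heights up to the new value, so the gap hypothesis survives. *)
Lemma lower_value u v m qb : rk_le u v ->
  (forall q, qb <= q <= u m -> rk u m q < rk v m q) ->
  exists w, [/\ rk_le u w, rk_le w v & w m < qb].
Proof.
have [N] := ubnP (u m : nat); elim: N u => // N IH u uN uv D.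
case: (ltnP (u m) qb) => um; first by exists u; split=> // p q.
have [a [am ua wv]] := raise_step uv (D _ (introT andP (conj um (leqnn _)))).
have uw := exchange_rk_le am ua.
have [||w [h1 h2 h3]] := IH (exchange u a m) _ wv.
- by rewrite exchangeR; lia.
- move=> q; rewrite exchangeR => /andP[qb1 qb2]; rewrite rk_exchange //.
  have := D q; lia.
by exists w; split=> //; apply: rk_trans uw h1.
Qed.

(** Conjugation by the longest permutation: it preserves [rk_le] and turns lowering a value into
    raising one. *)
Definition reverse u : {perm 'I_n} :=
  (perm (@rev_ord_inj n) * u * perm (@rev_ord_inj n))%g.

Lemma reverseE u k : reverse u k = rev_ord (u (rev_ord k)).
Proof. by rewrite !permM !permE. Qed.

Lemma reverseK u : reverse (reverse u) = u.
Proof. by apply/permP => k; rewrite !reverseE !rev_ordK. Qed.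

Lemma rk_reverse u p q : p <= n -> q <= n ->
  rk (reverse u) p q + q = rk u (n - p) (n - q) + p.
Proof.
move=> pn qn.
have cnt r : r <= n -> \sum_(k < n) (k < r) = r.
  move=> rn; transitivity (\sum_(k < n | k < r) 1).
    by rewrite [RHS]big_mkcond; apply: eq_bigr => k _; case: (k < r).
  by rewrite -(big_ord_widen n (fun=> 1)) // sum1_card card_ord.
have -> : rk (reverse u) p q = \sum_(k < n) ((n - p <= k) && (u k < n - q)).
  rewrite /rk (reindex_inj (@rev_ord_inj n)); apply: eq_bigr => k _.
  rewrite reverseE rev_ordK /=; have := ltn_ord k; have := ltn_ord (u k); lia.
have cp : \sum_(k < n) (n - p <= k) = p.
  rewrite -[RHS](cnt p) // (reindex_inj (@rev_ord_inj n)); apply: eq_bigr => k _ /=.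
  have := ltn_ord k; lia.
have cq : \sum_(k < n) (n - q <= u k) = q.
  rewrite -[RHS](cnt q) // (reindex_inj (@perm_inj _ (u^-1)%g)).
  rewrite (reindex_inj (@rev_ord_inj n)); apply: eq_bigr => k _ /=.
  by rewrite permKV /=; have := ltn_ord k; lia.
rewrite -[X in _ + X = _]cq -[X in _ = _ + X]cp /rk -!big_split.
by apply: eq_bigr => k _ /=; lia.
Qed.

Lemma reverse_rk_le u v : rk_le u v -> rk_le (reverse u) (reverse v).
Proof.
move=> uv p q; have trunc w : rk w p q = rk w (minn p n) q.
  by rewrite /rk; apply: eq_bigr => k _; have := ltn_ord k; lia.
rewrite !trunc; case: (leqP q n) => qn.
  have pn : minn p n <= n by lia.
  have := rk_reverse u pn qn; have := rk_reverse v pn qn.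
  have := uv (n - minn p n) (n - q); lia.
rewrite {1}/rk big1 // => k _; apply/eqP; rewrite eqb0.
have := ltn_ord (reverse u k); lia.
Qed.

Lemma raise_value u v m qt : rk_le u v -> qt <= n ->
  (forall q, u m < q <= qt -> rk u m.+1 q < rk v m.+1 q) ->
  exists w, [/\ rk_le u w, rk_le w v & qt <= w m].
Proof.
move=> uv qtn D; have rm : n - rev_ord m = m.+1 by rewrite /= subKn.
have [|w [h1 h2 h3]] := @lower_value (reverse u) (reverse v) (rev_ord m) (n - qt)
  (reverse_rk_le uv).
  move=> q; rewrite reverseE rev_ordK => qP'; have qP : n - qt <= q <= n - (u m).+1 by [].
  have qn : q <= n by have := ltn_ord (u m); lia.
  have pn : rev_ord m <= n by apply: ltnW; apply: ltn_ord.
  have := rk_reverse u pn qn; have := rk_reverse v pn qn; rewrite rm.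
  have := D (n - q); have := ltn_ord (u m); lia.
exists (reverse w); split.
- by rewrite -[u]reverseK; apply: reverse_rk_le.
- by rewrite -[v]reverseK; apply: reverse_rk_le.
- by rewrite reverseE /=; have := ltn_ord (w (rev_ord m)); lia.
Qed.

(* Either [u] and [v] differ by at least one in all ranks just after [t0] (if
   [u t0 <= v t0]) or just before it; up to the next element of [U] on that side
   this gap is constant, and it lets that element change its level inside [u, v]. *)
Lemma interval_adjacent u v (U S : {set 'I_n}) (t0 : 'I_n) qb qt wL wH :
  qb <= qt -> qt <= n -> rk_le u v ->
  (forall w, rk_le u w -> rk_le w v -> forall k, k \in S -> qt <= w k) ->
  (forall w, rk_le u w -> rk_le w v -> forall k, k \notin S :|: U -> w k < qb) ->
  rk_le u wL -> rk_le wL v -> wL t0 < qb ->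
  rk_le u wH -> rk_le wH v -> qt <= wH t0 -> t0 \in U ->
  exists a w, [/\ adjacent U a t0 \/ adjacent U t0 a, rk_le u w, rk_le w v &
    (w a < qb) || (qt <= w a)].
Proof.
move=> qbt qtn uv HS HZ uL Lv L0 uH Hv H0 t0U.
have refl x : rk_le x x by move=> p q.
(* Positions in [S] are always high and those outside [S :|: U] always low, so only positions in [U]
   can change the gap at a middle height. *)
have outside k q : k \notin U -> qb <= q <= qt -> (q <= u k) = (q <= v k).
  move=> kU qP; case: (boolP (k \in S)) => kS.
    have := HS u (refl u) uv k kS; have := HS v uv (refl v) k kS; lia.
  have kSU : k \notin S :|: U by rewrite !inE negb_or kS.
  have := HZ u (refl u) uv k kSU; have := HZ v uv (refl v) k kSU; lia.
have const p p' q : p <= p' -> (forall k, p <= k < p' -> k \notin U) -> qb <= q <= qt ->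
    rk u p q + rk v p' q = rk u p' q + rk v p q.
  move=> pp' noU qP; rewrite /rk -!big_split; apply: eq_bigr => k _ /=.
  case: (boolP (p <= k < p')) => kp; last by lia.
  have := outside k q (noU k kp) qP; lia.
(* Pass through [wL], whose low value at [t0] contributes nothing at height [q]; for [i2], [wH]
   contributes one. *)
have i1 q : qb <= q -> rk u t0.+1 q <= rk v t0 q.
  move=> qP; apply: leq_trans (uL _ _) _; apply: leq_trans (Lv t0 q).
  by rewrite rkS; lia.
have i2 q : q <= qt -> rk u t0 q < rk v t0.+1 q.
  move=> qP; apply: leq_trans (Hv _ _); rewrite rkS; have := uH t0 q; lia.
case: (leqP (u t0) (v t0)) => uv0.
  have D q : qb <= q <= qt -> rk u t0.+1 q < rk v t0.+1 q.
    move=> /andP[qb1 qt1]; have := i1 q qb1; have := i2 q qt1; rewrite !rkS; lia.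
  (* Without such an element the gap would persist to position [n], where all ranks agree; on the
     other side, to position 0. *)
  have [a aU ta] : exists2 a, a \in U & t0 < a.
    apply: contrapT => no; have := D qb; rewrite leqnn qbt => /(_ isT).
    have := @const t0.+1 n qb (ltn_ord t0); rewrite leqnn qbt (rk_total u v) => h.
    have := h _ isT; suff noU : forall k : 'I_n, t0 < k < n -> k \notin U.
      by move=> /(_ noU); lia.
    by move=> k /andP[tk _]; apply/negP => kU; apply: no; exists k.
  have [b tb] := adjacent_succ t0U aU ta; have [_ bU t0b no] := tb.
  case: (leqP qt (u b)) => ub; first by exists b, u; split; [right| | |rewrite ub orbT].
  have [|w [h1 h2 h3]] := @lower_value u v b qb uv; last first.
    by exists b, w; split=> //; [right|rewrite h3].
  move=> q qP; have qP' : qb <= q <= qt by lia.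
  have := D q qP'; have := const t0.+1 b q t0b _ qP'.
  suff noU : forall k : 'I_n, t0 < k < b -> k \notin U by move=> /(_ noU); lia.
  by move=> k kP; apply/negP => /no; rewrite kP.
have D q : qb <= q <= qt -> rk u t0 q < rk v t0 q.
  move=> /andP[qb1 qt1]; have := i1 q qb1; have := i2 q qt1; rewrite !rkS; lia.
have [a aU ta] : exists2 a, a \in U & a < t0.
  apply: contrapT => no; have := D qb; rewrite leqnn qbt => /(_ isT).
  have := @const 0 t0 qb isT; rewrite leqnn qbt !rk0 => h.
  have := h _ isT; suff noU : forall k : 'I_n, 0 <= k < t0 -> k \notin U.
    by move=> /(_ noU); lia.
  by move=> k /andP[_ tk]; apply/negP => kU; apply: no; exists k.
have [b tb] := adjacent_pred t0U aU ta; have [bU _ t0b no] := tb.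
case: (ltnP (u b) qb) => ub; first by exists b, u; split; [left| | |rewrite ub].
have [|w [h1 h2 h3]] := @raise_value u v b qt uv qtn; last first.
  by exists b, w; split=> //; [left|rewrite h3 orbT].
move=> q qP; have qP' : qb <= q <= qt by lia.
have := D q qP'; have := const b.+1 t0 q t0b _ qP'.
suff noU : forall k : 'I_n, b < k < t0 -> k \notin U by move=> /(_ noU); lia.
by move=> k kP; apply/negP => /no; rewrite kP.
Qed.
End Bruhat.

(** * Bruhat subdivisions *)

Section BruhatPolytopes.
Variables (R : realType) (n s : nat) (d : 'I_s -> nat).
Variable mu : 'I_s -> {set 'I_n} -> \bar R.
Implicit Types (B S T : {set 'I_n}) (i j : 'I_s) (t : 'I_n) (u v w : {perm 'I_n}).
Hypothesis mu_flag : valuated_flag_matroid d mu.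

(** The sets of the flag whose indicator vectors add up to [piB R d w]. *)
Definition level_set w j : {set 'I_n} := [set k : 'I_n | (n - d j <= w k)%N]%SET.

Lemma rank_le j : (d j <= n)%N.
Proof.
have [_ vm _] := mu_flag; have [_ [B [<- _]] _] := vm j.
by rewrite -[leqRHS]card_ord max_card.
Qed.

Lemma card_level_set w j : #|level_set w j| = d j.
Proof.
rewrite -(card_imset _ (@perm_inj _ w)).
have -> : w @: level_set w j = [set c : 'I_n | (n - d j <= c)%N]%SET.
  apply/setP => c; rewrite inE; apply/imsetP/idP => [[k] /[swap] ->|cd].
    by rewrite inE.
  by exists ((w^-1)%g c); rewrite ?inE permKV.
rewrite cardsE -sum1_card big_mkcond (reindex_inj (@rev_ord_inj n)) -big_mkcond /=.
rewrite (eq_bigl (fun c : 'I_n => (c < d j)%N)) => [|c]; last first.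
  by rewrite unfold_in /=; have := ltn_ord c; have := rank_le j; lia.
by rewrite -(big_ord_widen n (fun=> 1%N) (rank_le j)) sum1_card card_ord.
Qed.

Lemma level_set_nested w j (k : 'I_s) : (j <= k)%N -> level_set w j \subset level_set w k.
Proof.
have [dP _ _] := mu_flag; rewrite leq_eqVlt => /orP[/eqP/val_inj->//|/dP jk].
by apply/fintype.subsetP => a; rewrite !inE; lia.
Qed.

Lemma piB_sum w : piB R d w = \sum_j eB R (level_set w j).
Proof.
apply/rowP => k; rewrite mxE summxE card_classical_set -sum1_card natr_sum.
rewrite big_mkcond; apply: eq_bigr => j _; rewrite mxE !inE.
by case: (_ <= _)%N.
Qed.

Section Cell.
Variables (x : 'rV[R]_n) (u v : {perm 'I_n}).
Hypothesis cellQ : cell d mu x = @Qpoly R n s d u v.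

Lemma interval_cell_bases w j : bruhat_le u w -> bruhat_le w v ->
  cell_bases d mu x j (level_set w j).
Proof.
move=> uw wv; move: j; apply: (@flag_polytope_chain R n s (cell_bases d mu x)).
- by move=> j B []; rewrite card_level_set.
- exact: level_set_nested.
- by rewrite -cellE cellQ -piB_sum; apply: conv_sub; exists w.
Qed.

(** The maxima of [priority B] over the constituents include [B], and their sum lies in the Bruhat
    polytope. By genericity it is the only possible maximal vertex, so it is [piB R d w] for some
    [w] in the interval, and the level sets of [w] are these maxima. *)
Lemma cell_basis_interval i B : cell_bases d mu x i B ->
  exists w, [/\ bruhat_le u w, bruhat_le w v & level_set w i = B].
Proof.
move=> bB; have [W WP] := choice (fun j =>
  exists_maximum (@priority R n B) (exists_cell_basis mu_flag x j)).
have WF j : cell_bases d mu x j (W j) by have [] := WP j.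
have Wmax j C : cell_bases d mu x j C -> weight (priority R B) C <= weight (priority R B) (W j).
  by have [_] := WP j; apply.
have WB : W i = B.
  have cW : #|W i| = #|B| by have [-> _] := WF i; have [-> _] := bB.
  have [le eq] := weight_separated (@priority_separated R n B) cW.
  by apply: eq; apply/eqP; rewrite eq_le le Wmax.
have dW : dotp (priority R B) (\sum_j eB R (W j)) = \sum_j weight (priority R B) (W j).
  by rewrite dotp_sum1; apply: eq_bigr => j _; rewrite dotp_eB.
have dpi w : dotp (priority R B) (piB R d w) = \sum_j weight (priority R B) (level_set w j).
  by rewrite piB_sum dotp_sum1; apply: eq_bigr => j _; rewrite dotp_eB.
have level w : bruhat_le u w -> bruhat_le w v ->
    dotp (priority R B) (piB R d w) = \sum_j weight (priority R B) (W j) ->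
    forall j, level_set w j = W j.
  move=> uw wv; rewrite dpi => e j; apply: (@weight_priority_inj R n B).
  have /(@psumr_eq0P _ _ _ _) h : \sum_j (weight (priority R B) (W j) -
      weight (priority R B) (level_set w j)) = 0 by rewrite sumrB e subrr.
  apply/eqP; rewrite eq_sym -subr_eq0 h // => k _; rewrite subr_ge0.
  by apply: Wmax; apply: interval_cell_bases.
have inQ : @Qpoly R n s d u v (\sum_j eB R (W j)).
  by rewrite -cellQ cellE; apply: flag_polytope_sum.
pose V := [set piB R d w | w in [set w | bruhat_le u w /\ bruhat_le w v]].
have le p : V p -> dotp (priority R B) p <= \sum_j weight (priority R B) (W j).
  move=> [w [uw wv] <-]; rewrite dpi; apply: ler_sum => j _.
  by apply: Wmax; apply: interval_cell_bases.
have uniq p : V p -> dotp (priority R B) p = \sum_j weight (priority R B) (W j) ->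
    p = \sum_j eB R (W j).
  move=> [w [uw wv] <-] /(level _ uw wv) lw; rewrite piB_sum.
  by apply: eq_bigr => j _; rewrite lw.
have [_ [w [uw wv] e]] := conv_face le uniq inQ dW.
by exists w; split=> //; rewrite -WB; apply: level => //; rewrite e.
Qed.
End Cell.

Lemma bruhat_lambda i i' S T t0 :
  bruhat_subdivision d mu -> plucker_pair d i i' S T ->
  t0 \in T :\: S -> lambda mu i i' S T t0 != +oo%E ->
  (forall t, t \in T :\: S -> (lambda mu i i' S T t0 <= lambda mu i i' S T t)%E) ->
  exists2 a, adjacent (T :\: S) a t0 \/ adjacent (T :\: S) t0 a &
    lambda mu i i' S T a = lambda mu i i' S T t0.
Proof.
move=> sub pp t0U fin0 opt0; have [dP vm _] := mu_flag.
have [ST cST _ cS cT] := plucker_pair_card dP pp.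
have [x [b1 b2 u1 u2]] := lambda_weight mu_flag pp t0U fin0 opt0.
have [u [v [uv _ cellQ]]] := sub x.
have qq : (n - d i' <= n - d i)%N by move: cST; rewrite cS cT; lia.
have high w : bruhat_le u w -> bruhat_le w v -> exists2 t, t \in T :\: S &
    level_set w i = t |: S /\ lambda mu i i' S T t = lambda mu i i' S T t0.
  by move=> uw wv; apply: u1; apply: (interval_cell_bases cellQ).
have low w : bruhat_le u w -> bruhat_le w v -> exists2 t, t \in T :\: S &
    level_set w i' = T :\ t /\ lambda mu i i' S T t = lambda mu i i' S T t0.
  by move=> uw wv; apply: u2; apply: (interval_cell_bases cellQ).
have inL w j k : (k \in level_set w j) = (n - d j <= w k)%N by rewrite inE.
have [wH [uH Hv eH]] := cell_basis_interval cellQ b1.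
have [wL [uL Lv eL]] := cell_basis_interval cellQ b2.
have [|||||||||||a [w [adj uw wv]]] := @interval_adjacent n u v (T :\: S) S t0
    (n - d i') (n - d i) wL wH qq.
- exact: leq_subr.
- exact: bruhat_le_rk.
- move=> w /rk_bruhat_le uw /rk_bruhat_le wv k kS; have [t _ [e _]] := high w uw wv.
  by rewrite -inL e !inE kS orbT.
- move=> w /rk_bruhat_le uw /rk_bruhat_le wv k; rewrite !inE negb_or negb_and negbK.
  case/andP=> kS; rewrite (negbTE kS) /= => kT; have [t _ [e _]] := low w uw wv.
  by rewrite ltnNge -inL e !inE (negbTE kT) andbF.
- exact: bruhat_le_rk.
- exact: bruhat_le_rk.
- by rewrite ltnNge -inL eL !inE eqxx.
- exact: bruhat_le_rk.
- exact: bruhat_le_rk.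
- by rewrite -inL eH !inE eqxx.
- exact: t0U.
have aU : a \in T :\: S by case: adj => -[].
have {}uw := rk_bruhat_le uw; have {}wv := rk_bruhat_le wv.
have /finset.setDP[aT aS] := aU.
(* A low value puts [a] outside [level_set w i'], which is [T :\ t]; a high value puts it inside
   [level_set w i], which is [t |: S]. Either way [a = t], of minimal lambda. *)
move=> /orP[wa|wa]; exists a => //.
  have [t _ [e <-]] := low w uw wv.
  move: wa; rewrite ltnNge -inL e !inE aT andbT negbK => /eqP-> //.
have [t _ [e <-]] := high w uw wv.
by move: wa; rewrite -inL e !inE (negbTE aS) orbF => /eqP->.
Qed.
End BruhatPolytopes.

(** Both minima equal the overall minimum: if it is finite it is attained at both parities, and
    otherwise all values are infinite. *)
Lemma bigmin_parity (R : realType) (L : nat -> \bar R) (N : nat) :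
  (forall k, (1 <= k < N.+1)%N -> L k != +oo%E ->
    (forall k', (1 <= k' < N.+1)%N -> (L k <= L k')%E) ->
    exists k', [/\ (1 <= k' < N.+1)%N, odd k' = ~~ odd k & L k' = L k]) ->
  forall b, (\big[Order.min/+oo%E]_(1 <= k < N.+1 | odd k == b) L k =
    \big[Order.min/+oo%E]_(1 <= k < N.+1 | odd k == ~~ b) L k)%E.
Proof.
move=> h; suff le b : (\big[Order.min/+oo%E]_(1 <= k < N.+1 | odd k == ~~ b) L k <=
    \big[Order.min/+oo%E]_(1 <= k < N.+1 | odd k == b) L k)%E.
  by move=> b; apply/eqP; rewrite eq_le le andbT -{1}[b]negbK le.
rewrite [leRHS]big_nat_cond; apply: le_bigmin; first exact: leey.
move=> k /andP[kN /eqP ob].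
have inN (k1 : nat) : (1 <= k1 < N.+1)%N -> k1 \in index_iota 1 N.+1 by rewrite mem_index_iota.
have kN' : (k.-1 < N)%N by lia.
case: (@arg_minP _ _ _ (Ordinal kN') xpredT (fun k : 'I_N => L k.+1) isT) => k0 _ k0min.
have k0le k1 : (1 <= k1 < N.+1)%N -> (L k0.+1 <= L k1)%E.
  move=> k1N; have k1N' : (k1.-1 < N)%N by lia.
  by have := k0min (Ordinal k1N') isT; rewrite /= prednK //; lia.
case: (eqVneq (L k0.+1) +oo%E) => fin0.
  by have := k0le k kN; rewrite fin0 leye_eq => /eqP->; apply: leey.
have k0N : (1 <= k0.+1 < N.+1)%N by rewrite /= ltnS ltn_ord.
have [k' [k'N ok' Lk']] := h k0.+1 k0N fin0 k0le.
have [k2 [k2N ok2 Lk2]] : exists k2, [/\ (1 <= k2 < N.+1)%N, odd k2 == ~~ b & L k2 = L k0.+1].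
  case: (eqVneq (odd k0.+1) (~~ b)) => [o|o]; first by exists k0.+1; rewrite o.
  by exists k'; rewrite ok' Lk'; split=> //; move: o; case: odd; case: b {ob}.
apply: (@le_trans _ _ (L k2)); last by rewrite Lk2 k0le.
by apply: bigmin_inf_seq (inN _ k2N) ok2 _.
Qed.

Local Open Scope ereal_scope.

Theorem theorem1p4 (R : realType) (n s : nat) (d : 'I_s -> nat)
    (mu : 'I_s -> {set 'I_n} -> \bar R) :
  valuated_flag_matroid d mu ->
  [/\ (totally_nonneg d mu ->
         forall (i i' : 'I_s) (S T : {set 'I_n}), plucker_pair d i i' S T ->
         forall k : nat, (1 <= k <= #|T :\: S|)%N ->
           Order.min (lamx mu i i' S T k.-1) (lamx mu i i' S T k.+1)
             <= lamx mu i i' S T k),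
      (bruhat_subdivision d mu ->
         forall (i i' : 'I_s) (S T : {set 'I_n}), plucker_pair d i i' S T ->
         forall k : nat, (1 <= k <= #|T :\: S|)%N ->
           lamx mu i i' S T k = \big[Order.min/+oo]_(l <- lamseq mu i i' S T) l ->
           lamx mu i i' S T k =
             Order.min (lamx mu i i' S T k.-1) (lamx mu i i' S T k.+1))
    & (flag_positroid_subdivision d mu ->
         forall (i i' : 'I_s) (S T : {set 'I_n}), plucker_pair d i i' S T ->
           \big[Order.min/+oo]_(1 <= k < #|T :\: S|.+1 | odd k) lamx mu i i' S T k =
           \big[Order.min/+oo]_(1 <= k < #|T :\: S|.+1 | ~~ odd k) lamx mu i i' S T k)].
Proof.
move=> mu_flag; have [dP _ _] := mu_flag.
split=> [nn i i' S T pp k kP|sub i i' S T pp k kP minE|sub i i' S T pp].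
- exact: (totally_nonneg_lambda dP nn pp kP).
- have lamx_ge j : lamx mu i i' S T k <= lamx mu i i' S T j.
    rewrite [leRHS]/lamx; case: (eqVneq j 0%N) => [_|j0]; first exact: leey.
    case: (ltnP j.-1 (size (lamseq mu i i' S T))) => jl.
      by rewrite minE; apply: ge_bigmin_seq => //; apply: mem_nth.
    by rewrite [leRHS]nth_default ?leey.
  (* A minimal value is below both neighbours, including the infinite ones at the ends; what remains
     is one neighbour that attains it. *)
  apply/eqP; rewrite eq_le le_min !lamx_ge /=.
  have [t0 t0U kE] := lamxP kP; rewrite kE in lamx_ge *.
  have opt t : t \in T :\: S -> lambda mu i i' S T t0 <= lambda mu i i' S T t.
    by move=> tU; rewrite -!lamxE.
  rewrite [leRHS]lamxE //; case: (eqVneq (lambda mu i i' S T t0) +oo) => [->|fin0].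
    exact: leey.
  have [a adj <-] := bruhat_lambda mu_flag sub pp t0U fin0 opt.
  have aU : a \in T :\: S by case: adj => -[].
  rewrite -lamxE // ge_min.
  by have [/index_adjacent e|/index_adjacent e] := adj; rewrite /= e lexx ?orbT.
- apply: etrans (etrans (@bigmin_parity _ (lamx mu i i' S T) #|T :\: S| _ true) _).
  + by apply: eq_bigl => k; rewrite eqb_id.
  + move=> k.
    rewrite ltnS => kP; have [t0 t0U kE] := lamxP kP; rewrite kE lamxE // => fin0 opt.
    have opt' t : t \in T :\: S -> lambda mu i i' S T t0 <= lambda mu i i' S T t.
      move=> tU; rewrite -(lamxE _ _ _ tU); apply: opt.
      by rewrite /= ltnS cardE index_mem mem_enum.
    have [t [tU ot lt]] := flag_positroid_lambda mu_flag sub pp t0U fin0 opt'.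
    exists (index t (enum (T :\: S))).+1; rewrite lamxE //; split=> //.
      by rewrite /= ltnS cardE index_mem mem_enum.
    by rewrite /= !index_below // ot.
  + by apply: eq_bigl => k; rewrite eqbF_neg.
Qed.
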